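(* Let $n\ge1$ be an integer. For $\lambda=(\lambda_1,\dots,\lambda_n)\in\mathrm{int}(E_n)$ and $a=(a_1,\dots,a_{n+1})\in(0,\infty)^{n+1}$ set $$\mathcal{I}_\lambda(a):=\exp\left(\int_{E_n}\log\Big(\sum_{i=1}^{n+1}t_ia_i\Big)\,d\mu_\lambda(t)\right).$$ Then $(\mathcal{I}_\lambda)_\lambda$ is a weighted multivariate mean (in the sense given in the context).
   Context: $E_n:=\{(t_1,\dots,t_n)\in\mathbb{R}^n: t_i\ge 0\ (i=1,\dots,n),\ \sum_{i=1}^n t_i\le 1\}$, and $\mathrm{int}(E_n)=\{(t_1,\dots,t_n): t_i>0\ (i=1,\dots,n),\ \sum_{i=1}^n t_i<1\}$. For $t\in E_n$, $t_{n+1}:=1-\sum_{i=1}^n t_i$; for $\lambda\in E_n$, $\lambda_{n+1}:=1-\sum_{i=1}^n\lambda_i$; $dt:=dt_1\cdots dt_n$ is Lebesgue measure. For $\lambda\in\mathrm{int}(E_n)$, $\mu_\lambda$ is the probability measure on $E_n$ given by $$d\mu_\lambda(t):=\frac{\sum_{i=1}^n\alpha_i^{-1}}{B_n(\alpha_1^{-1},\dots,\alpha_n^{-1})}\prod_{i=1}^n t_i^{\alpha_i^{-1}-1}\,dt,\qquad \alpha_i:=\frac{\lambda_{n+1}}{\lambda_i},$$ where $B_n(x_1,\dots,x_n)=\prod_{i=1}^n\Gamma(x_i)\big/\Gamma(\sum_{i=1}^n x_i)$ is the multivariate beta function (so $B_1=1$). Let $(e_1,\dots,e_n)$ be the canonical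 basis of $\mathbb{R}^n$, $\mathbf{0}$ the zero vector of $\mathbb{R}^n$, and $e:=\frac1{n+1}(1,\dots,1)\in\mathbb{R}^n$. A family of maps $m_\lambda:(0,\infty)^{n+1}\to(0,\infty)$, $\lambda\in\mathrm{int}(E_n)$, is a weighted multivariate mean if: (i) for every $\lambda$ and every $a\in(0,\infty)^{n+1}$, $\min(a_1,\dots,a_{n+1})\le m_\lambda(a)\le\max(a_1,\dots,a_{n+1})$; (ii) for every $a$, $m_{e_i}(a)=a_i$ for $i=1,\dots,n$ and $m_{\mathbf{0}}(a)=a_{n+1}$, where $m_{e_i}(a)$ and $m_{\mathbf 0}(a)$ are understood as the limits of $m_\lambda(a)$ as $\lambda\to e_i$, respectively $\lambda\to\mathbf{0}$, with $\lambda\in\mathrm{int}(E_n)$; (iii) $m_e(a_1,\dots,a_{n+1})$ is symmetric in $a_1,\dots,a_{n+1}$; (iv) for every $\lambda$, the first partial derivatives of $a\mapsto m_\lambda(a)$ exist at $(1,\dots,1)\in\mathbb{R}^{n+1}$ and $\frac{\partial m_\lambda}{\partial a_i}(1,\dots,1)=\lambda_i$ for all $i=1,\dots,n+1$. *)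

(* Defs.v *)
From HB Require Import structures.
From mathcomp Require Import all_boot all_order all_algebra perm.
From mathcomp Require Import all_classical all_reals all_analysis
  measurable_realfun.

Set Implicit Arguments.
Unset Strict Implicit.
Unset Printing Implicit Defensive.
Import Order.TTheory GRing.Theory Num.Theory.
Import numFieldNormedType.Exports.
Local Open Scope classical_set_scope.
Local Open Scope ring_scope.

Section lebesgue_tuple.
Context {R : realType}.
Local Open Scope ereal_scope.
Let T := measurableTypeR R.

(* [lebesgue_tuple n] is n-dimensional Lebesgue measure on R^n = n.-tuple R
   (with the product Borel sigma-algebra), as the iterated product measure;
   on R^0 = {[tuple]} it is the unit mass. *)
Fixpoint lebesgue_tuple (n : nat) : set (n.-tuple T) -> \bar R :=
  match n return set (n.-tuple T) -> \bar R with
  | 0 => \d_([tuple] : 0.-tuple T)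
  | n'.+1 => pushforward (@lebesgue_measure R \x @lebesgue_tuple n')
               (fun p : T * n'.-tuple T => [tuple of p.1 :: p.2])
  end.

Let cons_t n (p : T * n.-tuple T) : n.+1.-tuple T := [tuple of p.1 :: p.2].
Let uncons_t n (t : n.+1.-tuple T) : T * n.-tuple T :=
  (thead t, [tuple of behead t]).

Let cons_tK n : cancel (@cons_t n) (@uncons_t n).
Proof. by case=> x t; congr pair; exact: val_inj. Qed.

Let uncons_tK n : cancel (@uncons_t n) (@cons_t n).
Proof. by move=> t; rewrite [RHS]tuple_eta. Qed.

Let measurable_cons_t n : measurable_fun setT (@cons_t n).
Proof. exact: measurable_cons. Qed.

Let measurable_uncons_t n : measurable_fun setT (@uncons_t n).
Proof.
by apply/measurable_fun_pairP; split; [exact: measurable_tnth|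
  exact: measurable_behead].
Qed.

Let sigma_finite_measure_prop n (m : set (n.-tuple T) -> \bar R) :=
  exists m' : {sigma_finite_measure set (n.-tuple T) -> \bar R}, m = m'.

Let lebesgue_tuple_prop n : sigma_finite_measure_prop (@lebesgue_tuple n).
Proof.
elim: n => [|n [m mE]]; first by exists (\d_([tuple] : 0.-tuple T)).
rewrite /sigma_finite_measure_prop/= mE.
pose nu : {measure set (n.+1.-tuple T) -> \bar R} :=
  measure_function_pushforward__canonical__measure_function_Measure
    (@lebesgue_measure R \x m) (@measurable_cons_t n).
have nu_sf : sigma_finite setT nu.
  have /sigma_finiteP[F [TF ndF Foo]] := sigma_finiteT (@lebesgue_measure R).
  have /sigma_finiteP[G [TG ndG Goo]] := sigma_finiteT m.
  exists (fun k => @uncons_t n @^-1` (F k `*` G k)).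
    rewrite -preimage_bigcup (_ : \bigcup_k _ = setT)//.
    apply/seteqP; split => // -[x y] _.
    have [k _ Fkx] : (\bigcup_k F k) x by rewrite -TF.
    have [l _ Gly] : (\bigcup_k G k) y by rewrite -TG.
    exists (maxn k l) => //; split.
    - by move: x Fkx; exact/subsetPset/ndF/leq_maxl.
    - by move: y Gly; exact/subsetPset/ndG/leq_maxr.
  move=> k; have [mF Fk] := Foo k; have [mG Gk] := Goo k; split.
    rewrite -[X in measurable X]setTI; apply: measurable_uncons_t => //.
    exact: measurableX.
  rewrite /nu/= /pushforward -comp_preimage.
  rewrite (_ : uncons_t (n:=n) \o _ = id); last first.
    by apply/funext => p; exact: cons_tK.
  by rewrite preimage_id product_measure1E// lte_mul_pinfty// ge0_fin_numE.
by exists (HB.pack_for {sigma_finite_measure set (n.+1.-tuple T) -> \bar R}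
  (Measure.sort nu) (Measure.class nu)
  (Measure_isSigmaFinite.Build _ _ _ (Measure.sort nu) nu_sf)).
Qed.

Let lebesgue_tuple0 n : @lebesgue_tuple n set0 = 0.
Proof. by have [m ->] := lebesgue_tuple_prop n. Qed.

Let lebesgue_tuple_ge0 n A : 0 <= @lebesgue_tuple n A.
Proof. by have [m ->] := lebesgue_tuple_prop n. Qed.

Let lebesgue_tuple_sigma_additive n : semi_sigma_additive (@lebesgue_tuple n).
Proof.
have [m ->] := lebesgue_tuple_prop n.
exact: measure_semi_sigma_additive.
Qed.

HB.instance Definition _ n := isMeasure.Build _ _ _ (@lebesgue_tuple n)
  (@lebesgue_tuple0 n) (@lebesgue_tuple_ge0 n)
  (@lebesgue_tuple_sigma_additive n).

Let lebesgue_tuple_sigma_finite n : sigma_finite setT (@lebesgue_tuple n).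
Proof. have [m ->] := lebesgue_tuple_prop n; exact: sigma_finiteT. Qed.

HB.instance Definition _ n := Measure_isSigmaFinite.Build _ _ _
  (@lebesgue_tuple n) (@lebesgue_tuple_sigma_finite n).

Lemma lebesgue_tuple_box n (A : 'I_n -> set T) :
  (forall i, measurable (A i)) ->
  @lebesgue_tuple n [set t | forall i, A i (tnth t i)] =
  \prod_(i < n) @lebesgue_measure R (A i).
Proof.
elim: n A => [|n IH] A mA.
  rewrite big_ord0 /= (_ : [set _ | _] = setT) ?diracT//.
  by apply/seteqP; split => // t _ [].
rewrite big_ord_recl -IH// /=.
rewrite -(product_measure1E (@lebesgue_measure R) (@lebesgue_tuple n))//.
  rewrite /pushforward; congr (_ _).
  apply/seteqP; split => -[x t] /=.
    move=> H; split; first exact: (H ord0).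
    by move=> i; have := H (lift ord0 i); rewrite tnthS.
  move=> [Ax At] i.
  by have [j ->|->//] := unliftP ord0 i; rewrite tnthS.
rewrite (_ : [set _ | _] = \bigcap_(i in setT)
   ((fun t : n.-tuple T => tnth t i) @^-1` A (lift ord0 i))); last first.
  by apply/seteqP; split=> [t H i _|t H i]; exact: H.
apply: fin_bigcap_measurable => // i _.
by rewrite -[X in measurable X]setTI; exact: measurable_tnth.
Qed.

End lebesgue_tuple.

Section weighted_mean.
Context {R : realType}.

(* (x_1, ..., x_n) |-> (x_1, ..., x_n, x_(n+1)) with
   x_(n+1) := 1 - (x_1 + ... + x_n); indices are shifted by one, so that
   ord_max stands for n+1. *)
Definition bary n (x : 'I_n -> R) (i : 'I_n.+1) : R :=
  if unlift ord_max i is Some j then x j else 1 - \sum_(j < n) x j.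

Definition simplex n : set (n.-tuple (measurableTypeR R)) :=
  [set t | (forall i, 0 <= tnth t i) /\ \sum_(i < n) tnth t i <= 1].

(* The interior is given in row vectors, which carry the topology of R^n,
   whereas tuples carry its Borel sigma-algebra. *)
Definition simplex_int n : set 'rV[R]_n :=
  [set l | (forall i, 0 < l ord0 i) /\ \sum_(i < n) l ord0 i < 1].

Definition Gamma (x : R) : R :=
  \int[lebesgue_measure]_(t in `]0, +oo[) (t `^ (x - 1) * expR (- t)).

Definition multi_beta n (x : 'I_n -> R) : R :=
  (\prod_(i < n) Gamma (x i)) / Gamma (\sum_(i < n) x i).

Definition alpha n (l : 'rV[R]_n) (i : 'I_n) : R :=
  bary (l ord0) ord_max / l ord0 i.

Definition mu_density n (l : 'rV[R]_n) (t : n.-tuple (measurableTypeR R)) : R :=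
  (\sum_(i < n) (alpha l i)^-1) / multi_beta (fun i => (alpha l i)^-1) *
  \prod_(i < n) tnth t i `^ ((alpha l i)^-1 - 1).

Definition mu_lambda n (l : 'rV[R]_n)
    (A : set (n.-tuple (measurableTypeR R))) : \bar R :=
  (\int[@lebesgue_tuple R n]_(t in A `&` @simplex n) (mu_density l t)%:E)%E.

Lemma Gamma_ge0 x : 0 <= Gamma x.
Proof. by apply: Rintegral_ge0 => t _; rewrite mulr_ge0 ?powR_ge0 ?expR_ge0. Qed.

Section mu_lambda_measure.
Context n (l : 'rV[R]_n).
Hypothesis hl : simplex_int l.

Let alphaV_ge0 i : 0 <= (alpha l i)^-1.
Proof.
case: hl => l_gt0 l_lt1; rewrite invr_ge0 divr_ge0//; last exact: ltW.
by rewrite /bary unlift_none subr_ge0 ltW.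
Qed.

Let mu_density_ge0 t : 0 <= mu_density l t.
Proof.
rewrite mulr_ge0//; last by apply: prodr_ge0 => i _; exact: powR_ge0.
rewrite divr_ge0 ?sumr_ge0// /multi_beta divr_ge0 ?Gamma_ge0//.
by apply: prodr_ge0 => i _; exact: Gamma_ge0.
Qed.

Let measurable_simplex : measurable (@simplex n).
Proof.
rewrite (_ : @simplex n =
  (\bigcap_(i in [set: 'I_n])
    ((fun t : n.-tuple (measurableTypeR R) => tnth t i) @^-1` `[0, +oo[)) `&`
  ((fun t : n.-tuple (measurableTypeR R) => \sum_(i < n) (tnth t i : R)) @^-1`
     `]-oo, 1])).
  apply: measurableI.
    apply: fin_bigcap_measurable => // i _.
    by rewrite -[X in measurable X]setTI; exact: measurable_tnth.
  rewrite -[X in measurable X]setTI; apply: measurable_sum => // i.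
  exact: measurable_tnth.
apply/seteqP; split => t /=.
  move=> [t0 t1]; split => [i _|]; first by rewrite /= in_itv/= andbT; exact: t0.
  by rewrite in_itv.
rewrite in_itv/= => -[t0 t1]; split => // i.
by have := t0 i I; rewrite /= in_itv/= andbT.
Qed.

Let measurable_mu_density : measurable_fun setT (mu_density l).
Proof.
apply: measurable_funM => //; apply: measurable_prod => i _.
apply: (measurableT_comp (measurable_powR ((alpha l i)^-1 - 1))).
exact: measurable_tnth.
Qed.

Let mu_lambda0 : mu_lambda l set0 = 0%E.
Proof. by rewrite /mu_lambda set0I integral_set0. Qed.

Let mu_lambda_ge0 A : (0 <= mu_lambda l A)%E.
Proof. by apply: integral_ge0 => t _; rewrite lee_fin. Qed.

Let mu_lambda_sigma_additive : semi_sigma_additive (mu_lambda l).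
Proof.
move=> A mA tA mUA.
rewrite /mu_lambda setI_bigcupl ge0_integral_bigcup//=.
- by apply: is_cvg_ereal_nneg_natsum_cond => k _ _; exact: mu_lambda_ge0.
- by move=> k; exact: measurableI.
- apply: measurable_funTS; exact/measurable_EFinP.
- by move=> t _; rewrite lee_fin.
- apply/trivIsetP => i j _ _ ij; rewrite setIACA setIid.
  by move/trivIsetP : tA => -> //; rewrite set0I.
Qed.

HB.instance Definition _ := isMeasure.Build _ _ _ (mu_lambda l)
  mu_lambda0 mu_lambda_ge0 mu_lambda_sigma_additive.

End mu_lambda_measure.

Definition I_mean n (l : 'rV[R]_n) (a : 'rV[R]_n.+1) : R :=
  expR (fine (\int[mu_lambda l]_(t in @simplex n)
    (ln (\sum_(i < n.+1) bary (tnth t) i * a ord0 i))%:E)%E).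

Definition positive_orthant n : set 'rV[R]_n :=
  [set a | forall i, 0 < a ord0 i].

(* [m] is total; only its values on [simplex_int] x [positive_orthant]
   matter. [widen_ord (leqnSn n) i] is the index i <= n seen in {1, ..., n+1}
   and [const_mx n.+1%:R^-1] is the barycentre e. *)
Record weighted_multivariate_mean n
    (m : 'rV[R]_n -> 'rV[R]_n.+1 -> R) : Prop := WeightedMultivariateMean {
  wmm_pos : forall l a, simplex_int l -> positive_orthant a -> 0 < m l a ;
  wmm_min_max : forall l a, simplex_int l -> positive_orthant a ->
    \big[Num.min/a ord0 ord0]_(i < n.+1) a ord0 i <= m l a
      <= \big[Num.max/a ord0 ord0]_(i < n.+1) a ord0 i ;
  wmm_vertex : forall a, positive_orthant a ->
    (forall i : 'I_n,
      m l a @[l --> within (@simplex_int n) (nbhs (delta_mx ord0 i : 'rV[R]_n))]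
        --> a ord0 (widen_ord (leqnSn n) i)) /\
    m l a @[l --> within (@simplex_int n) (nbhs (0 : 'rV[R]_n))]
      --> a ord0 ord_max ;
  wmm_sym : forall (s : 'S_n.+1) a, positive_orthant a ->
    m (const_mx n.+1%:R^-1) (col_perm s a) = m (const_mx n.+1%:R^-1) a ;
  wmm_deriv : forall l, simplex_int l -> forall i : 'I_n.+1,
    derivable (m l) (const_mx 1) (delta_mx ord0 i) /\
    'D_(delta_mx ord0 i) (m l) (const_mx 1) = bary (l ord0) i
}.

End weighted_mean.

(* Main.v *)
(** With [beta_i = lambda_i / lambda_(n+1)], [mu_lambda] is the Dirichlet law
    of parameters [(beta_1, ..., beta_n, 1)].  Let [D(s)] be the integral of
    [prod_i t_i^(beta_i - 1)] over the simplex of size [s].  By scaling,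
    [D(s) = s^(sum_i beta_i) D(1)], while by Tonelli the integral over [s] of
    [exp(-s) D(s)] is [prod_i Gamma(beta_i)]; hence
    [D(1) = prod_i Gamma(beta_i) / Gamma(sum_i beta_i + 1)].  This gives total
    mass 1 and, raising one exponent by 1, [E(t_i) = lambda_i] for
    [i = 1, ..., n + 1].

    Everything but symmetry uses only these first moments: the bounds by min
    and max are pointwise, the limits at the vertices come from
    [|ln y - ln a_k| <= |y - a_k| / min a], and the derivative at [(1, ..., 1)]
    from [y - 2 y^2 <= ln (1 + y) <= y] for [|y| <= 1/2].  At the barycentre
    the law is uniform on the simplex, and exchanging [t_j] and [t_(n+1)]
    amounts, for fixed other coordinates, to a reflection of [t_j]; these
    exchanges generate the symmetric group. *)

Require Import Defs.
From mathcomp Require Import all_boot all_order all_algebra fingroup perm.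
From mathcomp Require Import all_classical all_reals all_analysis
  measurable_realfun.
From mathcomp Require Import ring lra.

Set Implicit Arguments.
Unset Strict Implicit.
Unset Printing Implicit Defensive.
Import Order.TTheory GRing.Theory Num.Theory.
Import numFieldNormedType.Exports.
Local Open Scope classical_set_scope.
Local Open Scope ring_scope.

(** * Lebesgue measure under affine maps *)

Section lebesgue_affine.
Context {R : realType}.
Local Open Scope ereal_scope.
Local Notation mu := (@lebesgue_measure R).
Local Notation T := (measurableTypeR R).

(** The pushforward of Lebesgue measure under [x |-> c - x] gives every half-open interval its
    length, so it is Lebesgue measure by uniqueness. *)
Lemma ge0_integral_reflect (c : R) (f : R -> \bar R) :
  measurable_fun [set: T] f -> (forall x, 0 <= f x) ->
  \int[mu]_x f (c - x)%R = \int[mu]_x f x.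
Proof.
move=> mf f0; pose phi (x : T) : T := (c - x)%R.
have mphi : measurable_fun setT phi by exact: measurable_funB.
rewrite -[LHS](@ge0_integral_pushforward _ _ _ _ _ _ mphi mu setT f)//.
apply: eq_measure_integral => /= A mA _.
apply/esym; apply: (@lebesgue_measure_unique R
  (measure_function_pushforward__canonical__measure_function_Measure
    mu mphi)) => // _ [[a b]] _ <-.
(* Reflection moves the closed end to the left, which leaves the length unchanged. *)
rewrite /= /pushforward (_ : phi @^-1` _ = `[(c - b)%R, (c - a)%R[%classic).
  by rewrite !lebesgue_measure_itv/= !lte_fin ltrD2l ltrN2 -!EFinB;
    congr (if _ then _%:E else _); ring.
by apply/seteqP; split=> x /=; rewrite !in_itv/= /phi; lra.
Qed.

(** The pushforward under [x |-> s * x] divides lengths by [s]; multiplied by [s] it agrees with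
    Lebesgue measure on intervals, hence everywhere. *)
Lemma ge0_integral_scale (s : R) (f : R -> \bar R) : (0 < s)%R ->
  measurable_fun [set: T] f -> (forall x, 0 <= f x) ->
  s%:E * \int[mu]_x f (s * x)%R = \int[mu]_x f x.
Proof.
move=> s0 mf f0; pose phi (x : T) : T := (s * x)%R.
have mphi : measurable_fun setT phi by exact: measurable_funM.
pose nu := measure_function_pushforward__canonical__measure_function_Measure
    mu mphi.
have -> : \int[mu]_x f (s * x)%R = \int[nu]_x f x.
  by rewrite [RHS]ge0_integral_pushforward.
have s0' : (0 <= s)%R by exact: ltW.
rewrite -(ge0_integral_mscale nu measurableT (NngNum s0'))//.
apply: eq_measure_integral => /= A mA _.
apply/esym; apply: (@lebesgue_measure_unique R
  (mscale (NngNum s0') nu)) => // _ [[a b]] _ <-.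
rewrite /= /mscale/= /pushforward.
rewrite (_ : phi @^-1` _ = `](a / s)%R, (b / s)%R]%classic).
  rewrite !lebesgue_measure_itv/= !lte_fin ltr_pM2r ?invr_gt0//.
  case: ifP => _; last by rewrite mule0.
  by rewrite -!EFinB -EFinM -mulrBl mulrC mulfVK// gt_eqF.
apply/seteqP; split=> x /=; rewrite !in_itv/= /phi.
  by rewrite ltr_pdivrMr// ler_pdivlMr// mulrC.
by rewrite ltr_pdivrMr// ler_pdivlMr// mulrC.
Qed.

End lebesgue_affine.

(** * Integration against a density and on tuples *)

Section integral_density.
Local Open Scope ereal_scope.
Context d (T : measurableType d) (R : realType).
Variables (mu nu : {measure set T -> \bar R}) (g : T -> R) (D : set T).
Hypotheses (mD : measurable D) (mg : measurable_fun D g).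
Hypothesis g0 : forall x, (0 <= g x)%R.
Hypothesis nuE : forall A, measurable A -> nu A = \int[mu]_(x in A `&` D) (g x)%:E.

Import HBNNSimple.

(** Monotone convergence along simple functions increasing to [f] reduces the claim to indicators,
    where it is [nuE]. *)
Lemma ge0_integral_density (f : T -> \bar R) :
  measurable_fun D f -> (forall x, D x -> 0 <= f x) ->
  \int[nu]_(x in D) f x = \int[mu]_(x in D) (f x * (g x)%:E).
Proof.
move=> mf f0; pose h := nnsfun_approx mD mf.
have mg' : measurable_fun D (EFin \o g) by exact/measurable_EFinP.
have -> : \int[nu]_(x in D) f x = limn (fun n => \int[nu]_(x in D) (h n x)%:E).
  rewrite -monotone_convergence//.
  - by apply: eq_integral => x /set_mem Dx; apply/esym/cvg_lim => //;
      exact: cvg_nnsfun_approx.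
  - by move=> n; exact/measurable_EFinP/measurable_funTS.
  - by move=> n x _; rewrite lee_fin.
  - by move=> x _ a b ab; rewrite lee_fin; exact/lefP/nd_nnsfun_approx.
have -> : \int[mu]_(x in D) (f x * (g x)%:E) =
    limn (fun n => \int[mu]_(x in D) ((h n x)%:E * (g x)%:E)).
  rewrite -monotone_convergence//.
  - apply: eq_integral => x /set_mem Dx; apply/esym/cvg_lim => //.
    by apply: cvgeZr => //; exact: cvg_nnsfun_approx.
  - move=> n; apply: emeasurable_funM => //.
    exact/measurable_EFinP/measurable_funTS.
  - by move=> n x _; rewrite mule_ge0 ?lee_fin.
  - move=> x _ a b ab; rewrite lee_wpmul2r ?lee_fin//.
    exact/lefP/nd_nnsfun_approx.
congr (limn _); apply/funext => n.
have mh r : measurable (h n @^-1` [set r]) by [].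
(* Both integrals are expanded over the finitely many level sets of the simple function [h n]. *)
transitivity (\sum_(r \in range (h n))
    \int[nu]_(x in D) (r * \1_(h n @^-1` [set r]) x)%:E).
  rewrite -ge0_integral_fsum//.
  - by apply: eq_integral => x _; rewrite fsumEFin// -fimfunE.
  - by move=> r; apply/measurable_EFinP/measurable_funTS/measurable_funM.
  - by move=> r x _; rewrite nnfun_muleindic_ge0.
transitivity (\sum_(r \in range (h n))
    \int[mu]_(x in D) ((r * \1_(h n @^-1` [set r]) x)%:E * (g x)%:E)); last first.
  rewrite -ge0_integral_fsum//.
  - apply: eq_integral => x _; rewrite -ge0_mule_fsuml => [|y].
      by rewrite fsumEFin// -fimfunE.
    exact: nnfun_muleindic_ge0.
  - move=> r; apply: emeasurable_funM => //.
    by apply/measurable_EFinP/measurable_funTS/measurable_funM.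
  - by move=> r x _; rewrite mule_ge0 ?lee_fin//; exact: nnfun_muleindic_ge0.
(* The witness [x0] with [h n x0 = r] serves to show that [r] is nonnegative when it is pulled out
   of the integral. *)
apply: eq_fsbigr => r; rewrite inE => -[x0 _ x0r].
rewrite integralZl_indic_nnsfun// integral_indic// nuE; last exact: measurableI.
under [RHS]eq_integral do rewrite EFinM -muleA.
rewrite ge0_integralZl//.
- congr (_ * _); rewrite -setIA setIid [LHS]integral_mkcondl.
  by apply: eq_integral => x _; rewrite epatch_indic muleC.
- by apply: emeasurable_funM => //; exact/measurable_EFinP/measurable_funTS.
- by move=> x _; rewrite mule_ge0 ?lee_fin.
- by rewrite -x0r lee_fin.
Qed.

End integral_density.

Section lebesgue_tuple_integral.
Context {R : realType}.
Local Open Scope ereal_scope.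
Local Notation T := (measurableTypeR R).
Local Notation mu := (@lebesgue_measure R).
Local Notation leb n := (@lebesgue_tuple R n).

Let cons_tuple n (p : T * n.-tuple T) : n.+1.-tuple T := [tuple of p.1 :: p.2].

Let measurable_cons_tuple n : measurable_fun setT (@cons_tuple n).
Proof. exact: measurable_cons. Qed.

Lemma integral_lebesgue_tuple0 (f : 0.-tuple T -> \bar R) :
  \int[leb 0%N]_t f t = f [tuple].
Proof.
have mf : measurable_fun setT f.
  rewrite (_ : f = cst (f [tuple])); first exact: measurable_cst.
  by apply/funext => t; rewrite tuple0.
by rewrite [LHS]integral_dirac//= diracT mul1e.
Qed.

Lemma ge0_integral_lebesgue_tupleS n (f : n.+1.-tuple T -> \bar R) :
  measurable_fun setT f -> (forall t, 0 <= f t) ->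
  \int[leb n.+1]_t f t = \int[mu]_x \int[leb n]_t f [tuple of x :: t].
Proof.
move=> mf f0; have -> : \int[leb n.+1]_t f t =
    \int[pushforward (mu \x leb n) (@cons_tuple n)]_t f t by [].
rewrite ge0_integral_pushforward//.
rewrite preimage_setT fubini_tonelli1//.
- exact: (measurableT_comp mf (@measurable_cons_tuple n)).
- by move=> p; exact: f0.
- exact: measurable_cons.
Qed.

(** Tonelli in the other order: with the first coordinate innermost, one-dimensional changes of that
    variable apply while the others are fixed. *)
Lemma ge0_integral_lebesgue_tupleS2 n (f : n.+1.-tuple T -> \bar R) :
  measurable_fun setT f -> (forall t, 0 <= f t) ->
  \int[leb n.+1]_t f t = \int[leb n]_t \int[mu]_x f [tuple of x :: t].
Proof.
move=> mf f0; have -> : \int[leb n.+1]_t f t =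
    \int[pushforward (mu \x leb n) (@cons_tuple n)]_t f t by [].
rewrite ge0_integral_pushforward//.
rewrite preimage_setT fubini_tonelli2//.
- exact: (measurableT_comp mf (@measurable_cons_tuple n)).
- by move=> p; exact: f0.
- exact: measurable_cons.
Qed.

(** Exchanges [t_j] with the slack [s - sum_k t_k]; for [s = 1] the slack is [t_(n+1)]. A general
    [s] is needed for induction on [n]: fixing the first coordinate [x] replaces [s] by [s - x]. *)
Definition tuple_reflect n (s : R) (j : 'I_n) (t : n.-tuple T) : n.-tuple T :=
  [tuple (if i == j then s - \sum_(k < n) (tnth t k : R) else tnth t i)%R | i < n].

Lemma measurable_tuple_reflect n s (j : 'I_n) :
  measurable_fun setT (tuple_reflect s j).
Proof.
apply/measurable_fun_tnthP => i.
rewrite (_ : _ \o _ = fun t : n.-tuple T =>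
    (if i == j then s - \sum_(k < n) (tnth t k : R) else tnth t i)%R); last first.
  by apply/funext => t /=; rewrite tnth_mktuple.
case: (i == j); last exact: measurable_tnth.
apply: measurable_funB => //; apply: measurable_sum => k.
exact: measurable_tnth.
Qed.

Lemma tuple_reflect_cons0 n s (x : T) (t : n.-tuple T) :
  tuple_reflect s ord0 [tuple of x :: t] =
  [tuple of (s - \sum_(k < n) (tnth t k : R) - x)%R :: t].
Proof.
apply: eq_from_tnth => i; rewrite tnth_mktuple big_ord_recl.
have [k ->|->] := unliftP ord0 i; first by rewrite !tnthS.
rewrite eqxx /=; under eq_bigr do rewrite tnthS.
by rewrite /tnth/= opprD addrA addrAC.
Qed.

Lemma tuple_reflect_consS n s (j : 'I_n) (x : T) (t : n.-tuple T) :
  tuple_reflect s (lift ord0 j) [tuple of x :: t] =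
  [tuple of x :: tuple_reflect (s - x) j t].
Proof.
apply: eq_from_tnth => i; rewrite tnth_mktuple big_ord_recl.
have [k ->|->//] := unliftP ord0 i; rewrite !tnthS tnth_mktuple.
rewrite (inj_eq lift_inj); case: ifP => // _.
under eq_bigr do rewrite tnthS.
by rewrite /tnth/= opprD addrA.
Qed.

(** Induction on [n]. If [j] is not the first index, the first coordinate is kept outermost and the
    induction hypothesis is used with [s - x]; if it is, the map reflects the first coordinate
    alone, about a centre that depends on the other ones. *)
Lemma ge0_integral_tuple_reflect n s (j : 'I_n) (f : n.-tuple T -> \bar R) :
  measurable_fun setT f -> (forall t, 0 <= f t) ->
  \int[leb n]_t f (tuple_reflect s j t) = \int[leb n]_t f t.
Proof.
elim: n s j f => [s []//|n IH] s j f mf f0.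
have mfr : measurable_fun setT (f \o tuple_reflect s j).
  by apply: measurableT_comp => //; exact: measurable_tuple_reflect.
have mfc (t : n.-tuple T) : measurable_fun setT (fun x : T => f [tuple of x :: t]).
  by apply: (measurableT_comp mf); apply: measurable_cons => //.
have mfc2 (x : T) : measurable_fun setT (fun t : n.-tuple T => f [tuple of x :: t]).
  by apply: (measurableT_comp mf); apply: measurable_cons => //.
have [k jk|j0] := unliftP ord0 j.
  rewrite (ge0_integral_lebesgue_tupleS mfr (fun t => f0 _)) (ge0_integral_lebesgue_tupleS mf f0).
  apply: eq_integral => x _; rewrite -(IH (s - x)%R k _ (mfc2 x) (fun t => f0 _)).
  by apply: eq_integral => t _; rewrite /= jk tuple_reflect_consS.
rewrite (ge0_integral_lebesgue_tupleS2 mfr (fun t => f0 _)) (ge0_integral_lebesgue_tupleS2 mf f0).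
apply: eq_integral => t _.
rewrite -[RHS](@ge0_integral_reflect _ (s - \sum_(k < n) (tnth t k : R))%R)//.
by apply: eq_integral => x _; rewrite /= j0 tuple_reflect_cons0.
Qed.

Definition tuple_scale n (s : R) (t : n.-tuple T) : n.-tuple T :=
  [tuple (s * tnth t i)%R | i < n].

Lemma measurable_tuple_scale n s : measurable_fun setT (@tuple_scale n s).
Proof.
apply/measurable_fun_tnthP => i.
rewrite (_ : _ \o _ = fun t : n.-tuple T => (s * tnth t i)%R); last first.
  by apply/funext => t /=; rewrite tnth_mktuple.
by apply: measurable_funM => //; exact: measurable_tnth.
Qed.

(** Induction on [n], each coordinate contributing one factor [s]. *)
Lemma ge0_integral_tuple_scale n s (f : n.-tuple T -> \bar R) : (0 < s)%R ->
  measurable_fun setT f -> (forall t, 0 <= f t) ->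
  (s ^+ n)%:E * \int[leb n]_t f (tuple_scale s t) = \int[leb n]_t f t.
Proof.
move=> s0; elim: n f => [|n IH] f mf f0.
  by rewrite expr0 mul1e !integral_lebesgue_tuple0; congr f; rewrite tuple0.
have mfr : measurable_fun setT (f \o tuple_scale s).
  by apply: measurableT_comp => //; exact: measurable_tuple_scale.
have mfc (t : n.-tuple T) : measurable_fun setT (fun x : T => f [tuple of x :: t]).
  by apply: (measurableT_comp mf); apply: measurable_cons => //.
have mfc2 (x : T) : measurable_fun setT (fun t : n.-tuple T => f [tuple of x :: t]).
  by apply: (measurableT_comp mf); apply: measurable_cons => //.
have mF : measurable_fun setT (fun x : T => \int[leb n]_t f [tuple of x :: t]).
  apply: (@measurable_fun_fubini_tonelli_F _ _ _ _ _ _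
    (fun p => f (cons_tuple p))) => [|p]; last exact: f0.
  exact: (measurableT_comp mf (@measurable_cons_tuple n)).
have scale_cons (x : T) (t : n.-tuple T) : tuple_scale s [tuple of x :: t] =
    [tuple of (s * x)%R :: tuple_scale s t].
  apply: eq_from_tnth => i; rewrite tnth_mktuple.
  by have [k ->|->//] := unliftP ord0 i; rewrite !tnthS tnth_mktuple.
rewrite (ge0_integral_lebesgue_tupleS mfr (fun t => f0 _)) (ge0_integral_lebesgue_tupleS mf f0).
have F0 (x : T) : 0 <= \int[leb n]_t f [tuple of x :: t].
  by apply: integral_ge0 => t _; exact: f0.
rewrite -[RHS](ge0_integral_scale s0 mF F0).
rewrite exprS EFinM -muleA; congr (_ * _).
rewrite -ge0_integralZl//.
- apply: eq_integral => x _; rewrite -[RHS](IH _ (mfc2 _) (fun t => f0 _)); congr (_ * _).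
  by apply: eq_integral => t _; rewrite /= scale_cons.
- apply: (@measurable_fun_fubini_tonelli_F _ _ _ _ _ _
    (fun p => (f \o tuple_scale s) (cons_tuple p))) => [|p]; last exact: f0.
  exact: (measurableT_comp mfr (@measurable_cons_tuple n)).
- by move=> x _; apply: integral_ge0 => t _; exact: f0.
- by rewrite lee_fin exprn_ge0// ltW.
Qed.

End lebesgue_tuple_integral.

(** * One-dimensional integrals of exponentials and powers *)

Section one_dimensional_integrals.
Context {R : realType}.
Local Notation mu := (@lebesgue_measure R).
Local Notation T := (measurableTypeR R).

Lemma integral_expRN_itvcy (c : R) :
  (\int[mu]_(s in `[c, +oo[) (expR (- s))%:E = (expR (- c))%:E)%E.
Proof.
have cE : continuous (fun s : R => expR (- s)).
  move=> s; apply: continuous_comp; last exact: continuous_expR.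
  exact: continuousN.
have dE (s : R) : is_derive s 1 (fun s => - expR (- s)) (expR (- s)).
  by apply: is_derive_eq; rewrite /GRing.scale/=; ring.
rewrite (@ge0_continuous_FTC2y R _ (fun s => - expR (- s)) c 0).
- by rewrite -EFinB sub0r opprK.
- by move=> s _; exact: expR_ge0.
- by apply: continuous_subspaceT => s; exact: cE.
- by rewrite -oppr0; apply: cvgN; exact: cvgr_expR.
- by move=> s _; exact: ex_derive.
- by apply: cvg_at_right_filter; apply: cvgN; exact: cE.
- by move=> s _; rewrite derive1E derive_val.
Qed.

(** The fundamental theorem of calculus with primitive [x^b / b], away from 0 because the integrand
    blows up there when [b < 1]. *)
Lemma integral_powR_itv (b e : R) : 0 < b -> 0 < e < 1 ->
  (\int[mu]_(x in `[e, 1%R]) (x `^ (b - 1))%:E = ((1 - e `^ b) / b)%:E)%E.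
Proof.
move=> b0 /andP[e0 e1].
have dpow (c x : R) : 0 < x -> {for x, continuous (fun y => y `^ c)}.
  move=> x0; apply: differentiable_continuous; apply/derivable1_diffP.
  by apply: derivable_powR; rewrite in_itv/= x0.
have dF (x : R) : 0 < x ->
    is_derive x 1 (fun y => b^-1 * y `^ b) (x `^ (b - 1)).
  move=> x0; have D := is_derive1_powR b x0; apply: is_derive_eq.
  by rewrite /GRing.scale/= mulrA mulVf ?mul1r// gt_eqF.
have cF (x : R) : 0 < x -> {for x, continuous (fun y => b^-1 * y `^ b)}.
  by move=> x0; apply: cvgM; [exact: cvg_cst|exact: dpow].
rewrite (@continuous_FTC2 R _ (fun x => b^-1 * x `^ b))//.
- by rewrite powR1 mulr1 -EFinB; congr EFin; rewrite mulrBl mul1r mulrC.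
- apply: continuous_in_subspaceT => x; rewrite inE/= in_itv/= => /andP[ex _].
  by apply: dpow; exact: lt_le_trans ex.
- split.
  + move=> x; rewrite in_itv/= => /andP[ex _].
    by have D := dF x (lt_trans e0 ex); exact: ex_derive.
  + by apply: cvg_at_right_filter; exact: cF.
  + by apply: cvg_at_left_filter; apply: cF.
- move=> x; rewrite in_itv/= => /andP[ex _]; rewrite derive1E.
  by have D := dF x (lt_trans e0 ex); exact: derive_val.
Qed.

(** Exhaustion of []0, 1]] by an increasing sequence of compact intervals; the boundary term [e^b]
    tends to 0 since [b > 0]. *)
Lemma integral_powR01 (b : R) : 0 < b ->
  (\int[mu]_(x in `]0%R, 1%R]) (x `^ (b - 1))%:E = (b^-1)%:E)%E.
Proof.
(* Starting from [1/2] rather than [1] keeps the left end strictly below 1, as [integral_powR_itv]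
   requires. *)
move=> b0; pose F k : set T := `[k.+2%:R^-1, 1]%classic.
have FE : `]0%R, 1%R]%classic = \bigcup_k F k.
  apply/seteqP; split=> x /=; last first.
    move=> [k _]; rewrite /F/= !in_itv/= => /andP[kx ->]; rewrite andbT.
    by apply: lt_le_trans kx; rewrite invr_gt0.
  rewrite in_itv/= => /andP[x0 x1].
  (* With [k] the integer part of [1/x], one has [1/x < k + 1 < k + 2]. *)
  exists (Num.truncn x^-1) => //; rewrite /F/= in_itv/= x1 andbT.
  rewrite invf_ple ?posrE ?ltr0n//; apply/ltW.
  apply: (lt_trans (truncnS_gt _)); by rewrite ltr_nat.
have mp : measurable_fun setT (fun x : T => (x `^ (b - 1))%:E).
  by apply/measurable_EFinP; exact: measurable_powR.
have ndF : nondecreasing_seq F.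
  move=> i j ij; apply/subsetPset => x; rewrite /F/= !in_itv/= => /andP[ix ->].
  by rewrite andbT (le_trans _ ix)// lef_pV2 ?posrE// ler_nat !ltnS.
have cv := @ge0_nondecreasing_set_cvg_integral _ T R F
  (fun x => (x `^ (b - 1))%:E) mu ndF (fun i => measurable_itv _)
  (fun i => measurable_funTS mp) (fun i x _ => powR_ge0 x (b - 1)).
rewrite FE; apply: (cvg_unique _ cv) => //=.
have lim : (1 - i.+2%:R^-1 `^ b) / b @[i --> \oo] --> b^-1.
  rewrite -[X in _ --> X]mul1r -[X in X * _]subr0.
  apply: cvgM; last exact: cvg_cst.
  apply: cvgB; first exact: cvg_cst.
  have /cvg_at_rightP := powR_cvg0 b0; apply; split=> [i|].
    by rewrite invr_gt0 ltr0n.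
  by have := @cvg_harmonic R; rewrite -cvg_shiftS.
rewrite (_ : (fun i => _) = EFin \o (fun i => (1 - i.+2%:R^-1 `^ b) / b)).
  by apply/fine_cvgP; split; first by near=> i.
apply/funext => i /=; rewrite integral_powR_itv// invr_gt0 ltr0n/=.
by rewrite invf_lt1 ?ltr0n// ltr1n.
Unshelve. all: by end_near. Qed.

Lemma measurable_indicator_le d (X : measurableType d) (f g : X -> R) :
  measurable_fun setT f -> measurable_fun setT g ->
  measurable_fun setT (fun x => (f x <= g x)%R%:R : R).
Proof.
move=> mf mg; rewrite (_ : (fun _ => _) = fun x => if f x <= g x then 1 else 0).
  by apply: measurable_fun_ifT => //; exact: measurable_fun_ler.
by apply/funext => x; case: (f x <= g x).
Qed.

(** The value of [f] at 0 is unconstrained since a point is negligible. *)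
Lemma integral_itv0y (f : R -> \bar R) : measurable_fun [set: T] f ->
  (forall s, s < 0 -> f s = 0%E) ->
  (\int[mu]_s f s = \int[mu]_(s in `]0%R, +oo[) f s)%E.
Proof.
move=> mf f0; rewrite integral_itv_obnd_cbnd; last exact: measurable_funTS.
rewrite [RHS]integral_mkcond; apply: eq_integral => s _; rewrite patchE.
case: ifPn => // /negP s0; apply: f0; rewrite ltNge; apply/negP => s0'.
by apply: s0; rewrite inE/= in_itv/= s0'.
Qed.

End one_dimensional_integrals.

(** * The Dirichlet integral *)

Section dirichlet.
Context {R : realType}.
Local Notation T := (measurableTypeR R).
Local Notation mu := (@lebesgue_measure R).
Local Notation leb n := (@lebesgue_tuple R n).

(** The sign constraint is built into the integrand, so that integrals run over the whole space,
    where the scaling and Tonelli lemmas are stated; it also discards the default values of [powR]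
    at negative bases. *)
Definition pow_kernel (b x : R) : R := x `^ (b - 1) * (0 <= x)%R%:R.

Lemma pow_kernel_ge0 b x : 0 <= pow_kernel b x.
Proof. by rewrite mulr_ge0 ?powR_ge0. Qed.

Lemma pow_kernel_lt0 b x : x < 0 -> pow_kernel b x = 0.
Proof. by rewrite /pow_kernel ltNge => /negPf ->; rewrite mulr0. Qed.

Lemma pow_kernelE b x : 0 <= x -> pow_kernel b x = x `^ (b - 1).
Proof. by rewrite /pow_kernel => ->; rewrite mulr1. Qed.

Lemma measurable_pow_kernel b : measurable_fun [set: T] (pow_kernel b).
Proof.
by apply: measurable_funM; [exact: measurable_powR|exact: measurable_indicator_le].
Qed.

Lemma measurable_gamma_integrand b :
  measurable_fun [set: T] (fun x => pow_kernel b x * expR (- x)).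
Proof.
apply: measurable_funM; first exact: measurable_pow_kernel.
by apply: (measurableT_comp (@measurable_expR R)); exact: measurable_funN.
Qed.

(** Gamma with values in the extended reals: Tonelli's theorem then gives identities before
    finiteness is known. *)
Definition egamma (b : R) : \bar R :=
  (\int[mu]_x (pow_kernel b x * expR (- x))%:E)%E.

Lemma egamma_ge0 b : (0 <= egamma b)%E.
Proof.
by apply: integral_ge0 => x _; rewrite lee_fin mulr_ge0 ?pow_kernel_ge0 ?expR_ge0.
Qed.

Lemma egammaE b :
  (egamma b = \int[mu]_(x in `]0%R, +oo[) (x `^ (b - 1) * expR (- x))%:E)%E.
Proof.
rewrite /egamma integral_itv0y; last 2 first.
- by apply/measurable_EFinP; exact: measurable_gamma_integrand.
- by move=> s s0; rewrite pow_kernel_lt0// mul0r.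
apply: eq_integral => x; rewrite inE/= in_itv/= andbT => x0.
by rewrite pow_kernelE// ltW.
Qed.

Lemma GammaE b : Gamma b = fine (egamma b).
Proof. by rewrite egammaE. Qed.

(** The integrand is a product of functions of separate variables, so Tonelli factors it one
    coordinate at a time. *)
Lemma integral_tuple_gamma n (b : 'I_n -> R) :
  (\int[leb n]_t (\prod_(i < n) (pow_kernel (b i) (tnth t i) *
                                 expR (- tnth t i)))%:E =
   \prod_(i < n) egamma (b i))%E.
Proof.
elim: n b => [|n IH] b; first by rewrite integral_lebesgue_tuple0 !big_ord0.
pose g i (x : T) : R := pow_kernel (b i) x * expR (- x).
have g0 i x : 0 <= g i x by rewrite mulr_ge0 ?pow_kernel_ge0 ?expR_ge0.
have mg i : measurable_fun setT (g i) by exact: measurable_gamma_integrand.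
have mtail : measurable_fun setT (fun t : n.-tuple T =>
    (\prod_(i < n) g (lift ord0 i) (tnth t i))%:E).
  apply/measurable_EFinP; apply: measurable_prod => i _.
  exact: (measurableT_comp (mg _) (measurable_tnth _)).
rewrite ge0_integral_lebesgue_tupleS; last 2 first.
- apply/measurable_EFinP; apply: measurable_prod => i _.
  exact: (measurableT_comp (mg i) (measurable_tnth i)).
- by move=> t; rewrite lee_fin prodr_ge0// => i _; exact: g0.
rewrite big_ord_recl -IH -ge0_integralZr//; last 3 first.
- by apply/measurable_EFinP; exact: mg.
- by move=> x _; rewrite lee_fin; exact: g0.
- by apply: integral_ge0 => t _; rewrite lee_fin prodr_ge0// => i _; exact: g0.
apply: eq_integral => x _; rewrite -ge0_integralZl//; last 2 first.
- by move=> t _; rewrite lee_fin prodr_ge0// => i _; exact: g0.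
- by rewrite lee_fin; exact: g0.
apply: eq_integral => t _; rewrite -EFinM big_ord_recl; congr (_ * _)%:E.
by apply: eq_bigr => i _; rewrite tnthS.
Qed.

(** The unnormalised Dirichlet density on the simplex of size [s], extended by 0; [s] is kept free
    because it becomes an integration variable. *)
Definition dirichlet_weight n (b : 'I_n -> R) (s : R) (t : n.-tuple T) : R :=
  \prod_(i < n) pow_kernel (b i) (tnth t i) * (\sum_(i < n) tnth t i <= s)%R%:R.

Definition dirichlet_integral n (b : 'I_n -> R) (s : R) : \bar R :=
  (\int[leb n]_t (dirichlet_weight b s t)%:E)%E.

Lemma dirichlet_weight_ge0 n (b : 'I_n -> R) s t : 0 <= dirichlet_weight b s t.
Proof.
by rewrite mulr_ge0// prodr_ge0// => i _; exact: pow_kernel_ge0.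
Qed.

Lemma measurable_dirichlet_weight2 n (b : 'I_n -> R) :
  measurable_fun [set: T * n.-tuple T] (fun p => dirichlet_weight b p.1 p.2).
Proof.
have mt i : measurable_fun [set: T * n.-tuple T] (fun p => tnth p.2 i).
  by apply: (measurableT_comp (measurable_tnth i)); exact: measurable_snd.
apply: measurable_funM.
  apply: measurable_prod => i _.
  exact: (measurableT_comp (measurable_pow_kernel (b i)) (mt i)).
by apply: measurable_indicator_le => //; apply: measurable_sum => i; exact: mt.
Qed.

Lemma measurable_dirichlet_weight n (b : 'I_n -> R) s :
  measurable_fun [set: n.-tuple T] (dirichlet_weight b s).
Proof.
apply: measurable_funM.
  apply: measurable_prod => i _.
  exact: (measurableT_comp (measurable_pow_kernel (b i)) (measurable_tnth i)).
apply: measurable_indicator_le => //; apply: measurable_sum => i.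
exact: measurable_tnth.
Qed.

Lemma dirichlet_integral_ge0 n (b : 'I_n -> R) s : (0 <= dirichlet_integral b s)%E.
Proof.
by apply: integral_ge0 => t _; rewrite lee_fin dirichlet_weight_ge0.
Qed.

(* The Laplace transform in [s] at 1 decouples the variables [t_i]. *)
Lemma laplace_dirichlet_integral n (b : 'I_n -> R) :
  (\int[mu]_s ((expR (- s))%:E * dirichlet_integral b s) =
   \prod_(i < n) egamma (b i))%E.
Proof.
pose f (p : T * n.-tuple T) : \bar R :=
  (expR (- p.1) * dirichlet_weight b p.1 p.2)%:E.
have mf : measurable_fun setT f.
  apply/measurable_EFinP; apply: measurable_funM.
    apply: (measurableT_comp (@measurable_expR R)).
    exact: measurable_funN.
  exact: measurable_dirichlet_weight2.
have f0 p : (0 <= f p)%E.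
  by rewrite lee_fin mulr_ge0 ?expR_ge0 ?dirichlet_weight_ge0.
transitivity (\int[mu]_s \int[leb n]_t f (s, t))%E.
  apply: eq_integral => s _; rewrite -ge0_integralZl//.
  - by apply/measurable_EFinP; exact: measurable_dirichlet_weight.
  - by move=> t _; rewrite lee_fin dirichlet_weight_ge0.
rewrite (fubini_tonelli f mf f0) -integral_tuple_gamma.
apply: eq_integral => t _; rewrite /f/=.
pose S : R := \sum_(i < n) tnth t i.
pose P := \prod_(i < n) pow_kernel (b i) (tnth t i).
have P0 : 0 <= P by apply: prodr_ge0 => i _; exact: pow_kernel_ge0.
(* For fixed [t] the constraint reads [S <= s], and the integral of [exp(-s)] over [[S, +oo[] is
   [exp(-S)], the product of the [exp(-t_i)]. *)
rewrite big_split/= -/P -expR_sum sumrN -/S EFinM -integral_expRN_itvcy.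
rewrite -ge0_integralZl//; last first.
  apply: measurable_funTS; apply/measurable_EFinP.
  by apply: (measurableT_comp (@measurable_expR R)); exact: measurable_funN.
rewrite [RHS]integral_mkcond; apply: eq_integral => s _; rewrite patchE.
rewrite /dirichlet_weight -/P -/S mem_setE in_itv/= andbT.
by case: ifP => _; rewrite ?mulr1 ?mulr0 ?mulr0// -EFinM mulrC.
Qed.

Lemma dirichlet_integral_lt0 n (b : 'I_n -> R) s : s < 0 ->
  dirichlet_integral b s = 0%E.
Proof.
move=> s0; apply: integral0_eq => t _; congr EFin; rewrite /dirichlet_weight.
have [/existsP[i ti]|] := boolP [exists i : 'I_n, tnth t i < 0].
  by rewrite (bigD1 i)//= pow_kernel_lt0// !mul0r.
rewrite negb_exists => /forallP t0; rewrite (_ : (_ <= s) = false) ?mulr0//.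
apply/negbTE; rewrite -ltNge (lt_le_trans s0)// sumr_ge0// => i _.
by rewrite leNgt t0.
Qed.

Lemma powR_sum (s : R) n (b : 'I_n -> R) : 0 < s ->
  s `^ (\sum_(i < n) b i) = \prod_(i < n) s `^ (b i).
Proof.
move=> s0; elim: n b => [|n IH] b; first by rewrite !big_ord0 powRr0.
by rewrite !big_ord_recl -IH powRD// (gt_eqF s0) implybT.
Qed.

(** Substituting [s t] for [t], the Jacobian [s^n] and the factors [s^(b_i - 1)] combine to
    [s^(sum_i b_i)]. *)
Lemma dirichlet_integral_scale n (b : 'I_n -> R) s : 0 < s ->
  dirichlet_integral b s =
  ((s `^ (\sum_(i < n) b i))%:E * dirichlet_integral b 1)%E.
Proof.
move=> s0; rewrite {1}/dirichlet_integral -(ge0_integral_tuple_scale s0).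
- rewrite powR_sum// -!ge0_integralZl//=.
  + apply: eq_integral => t _; rewrite -!EFinM; congr EFin.
    rewrite /dirichlet_weight !mulrA.
    rewrite (_ : (_ <= s) = (\sum_(i < n) tnth t i <= 1)); last first.
      under eq_bigr do rewrite tnth_mktuple.
      by rewrite -mulr_sumr -[X in _ <= X]mulr1 ler_pM2l.
    (* [s^n] is written as a product of [n] factors [s], so that the comparison is made coordinate
       by coordinate. *)
    congr (_ * _); rewrite -big_split/= -[X in s ^+ X](card_ord n).
    rewrite -prodr_const -big_split/=; apply: eq_bigr => i _.
    rewrite tnth_mktuple /pow_kernel pmulr_rge0//.
    have [t0|t0] := leP 0 (tnth t i); last by rewrite !mulr0.
    rewrite !mulr1 powRM ?(ltW s0)// mulrA; congr (_ * _).
    rewrite powRB; last by rewrite (gt_eqF s0) implybT.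
    by rewrite powRr1 ?(ltW s0)// mulrC mulfVK// gt_eqF.
  + by apply/measurable_EFinP; exact: measurable_dirichlet_weight.
  + by move=> t _; rewrite lee_fin dirichlet_weight_ge0.
  + by rewrite lee_fin prodr_ge0// => i _; exact: powR_ge0.
  + apply/measurable_EFinP.
    exact: (measurableT_comp (measurable_dirichlet_weight b s)
                             (measurable_tuple_scale s)).
  + by move=> t _; rewrite lee_fin dirichlet_weight_ge0.
  + by rewrite lee_fin exprn_ge0// ltW.
- by apply/measurable_EFinP; exact: measurable_dirichlet_weight.
- by move=> t; rewrite lee_fin dirichlet_weight_ge0.
Qed.

(** In the Laplace transform, scaling replaces [dirichlet_integral b s] by [s^(sum_i b_i)] times a
    constant, and what remains is a Gamma integral with parameter [sum_i b_i + 1]. *)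
Lemma dirichlet_formula n (b : 'I_n -> R) :
  (\prod_(i < n) egamma (b i) =
   egamma (\sum_(i < n) b i + 1) * dirichlet_integral b 1)%E.
Proof.
rewrite -laplace_dirichlet_integral integral_itv0y; last 2 first.
- apply: emeasurable_funM.
    apply/measurable_EFinP; apply: (measurableT_comp (@measurable_expR R)).
    exact: measurable_funN.
  apply: (@measurable_fun_fubini_tonelli_F _ _ _ _ _ _
    (fun p : T * n.-tuple T => (dirichlet_weight b p.1 p.2)%:E)) => [|p].
    by apply/measurable_EFinP; exact: measurable_dirichlet_weight2.
  by rewrite lee_fin dirichlet_weight_ge0.
- by move=> s s0; rewrite dirichlet_integral_lt0// mule0.
rewrite egammaE -ge0_integralZr; last 1 first.
- exact: dirichlet_integral_ge0.
- apply: eq_integral => s; rewrite inE/= in_itv/= andbT => s0.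
  by rewrite dirichlet_integral_scale// muleA -EFinM addrK mulrC.
- exact: measurable_itv.
- apply: measurable_funTS; apply/measurable_EFinP; apply: measurable_funM.
    exact: measurable_powR.
  by apply: (measurableT_comp (@measurable_expR R)); exact: measurable_funN.
- by move=> s _; rewrite lee_fin mulr_ge0 ?powR_ge0 ?expR_ge0.
Qed.

End dirichlet.

(** * Recurrence, finiteness and positivity of the Gamma function *)

Section gamma.
Context {R : realType}.
Local Notation T := (measurableTypeR R).
Local Notation mu := (@lebesgue_measure R).

Lemma dirichlet_integral1 (b : R) : 0 < b ->
  dirichlet_integral (fun _ : 'I_1 => b) 1 = (b^-1)%:E.
Proof.
move=> b0; rewrite /dirichlet_integral ge0_integral_lebesgue_tupleS; last 2 first.
- by apply/measurable_EFinP; exact: measurable_dirichlet_weight.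
- by move=> t; rewrite lee_fin dirichlet_weight_ge0.
rewrite -integral_powR01// integral_itv_obnd_cbnd; last first.
  by apply: measurable_funTS; apply/measurable_EFinP; exact: measurable_powR.
rewrite [RHS]integral_mkcond; apply: eq_integral => x _.
rewrite integral_lebesgue_tuple0 /dirichlet_weight !big_ord_recl !big_ord0.
rewrite patchE mem_setE in_itv/= mulr1 addr0 /tnth/= /pow_kernel.
by case: (0 <= x); case: (x <= 1); rewrite ?mulr0 ?mul0r ?mulr1.
Qed.

(** The Dirichlet formula for [n = 1], where the Dirichlet integral is [1/b]; this takes the place
    of an integration by parts. *)
Lemma egamma_rec (b : R) : 0 < b -> egamma (b + 1) = (b%:E * egamma b)%E.
Proof.
move=> b0; have := dirichlet_formula (fun _ : 'I_1 => b).
rewrite !big_ord_recl !big_ord0 mule1 addr0 dirichlet_integral1// => ->.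
by rewrite muleC -muleA -EFinM mulVf ?mule1// gt_eqF.
Qed.

Lemma egamma1 : egamma (1 : R) = 1%E.
Proof.
rewrite egammaE integral_itv_obnd_cbnd; last first.
  apply: measurable_funTS; apply/measurable_EFinP; apply: measurable_funM.
    exact: measurable_powR.
  by apply: (measurableT_comp (@measurable_expR R)); exact: measurable_funN.
under eq_integral do rewrite subrr powRr0 mul1r.
by rewrite integral_expRN_itvcy oppr0 expR0.
Qed.

Lemma egamma_nat_fin_num n : egamma (n.+1%:R : R) \is a fin_num.
Proof.
elim: n => [|n IH]; first by rewrite egamma1.
by rewrite -natr1 egamma_rec// fin_numM.
Qed.

(** The recurrence reduces to [egamma (b + 1)], whose integrand has no singularity at 0. There
    [x^b <= 1 + x^N] for an integer [N >= b]: the first term dominates on [[0, 1]], the second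
    beyond 1. *)
Lemma egamma_fin_num (b : R) : 0 < b -> egamma b \is a fin_num.
Proof.
move=> b0; rewrite -[egamma b]mul1e -(@mulVf _ b) ?gt_eqF// EFinM -muleA.
rewrite -egamma_rec// fin_numM// ge0_fin_numE ?egamma_ge0//.
pose N := (Num.truncn b).+1.
have bN : b <= N%:R by apply/ltW; exact: truncnS_gt.
apply: (@le_lt_trans _ _ (egamma 1 + egamma (N.+1%:R : R))%E); last first.
  by rewrite lte_add_pinfty// -ge0_fin_numE ?egamma_ge0// ?egamma1// egamma_nat_fin_num.
rewrite /egamma -ge0_integralD//.
- apply: ge0_le_integral => //.
  + by move=> x _; rewrite lee_fin mulr_ge0 ?pow_kernel_ge0 ?expR_ge0.
  + by apply/measurable_EFinP; exact: measurable_gamma_integrand.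
  + apply: emeasurable_funD; apply/measurable_EFinP;
      exact: measurable_gamma_integrand.
  + move=> x _; rewrite -EFinD lee_fin -mulrDl ler_wpM2r ?expR_ge0//.
    have [x0|x0] := leP 0 x; last by rewrite !pow_kernel_lt0// addr0.
    rewrite !pow_kernelE// addrK subrr powRr0 -natr1 addrK.
    have [x1|x1] := leP x 1.
      rewrite ler_wpDr ?powR_ge0//.
      move: x0; rewrite le_eqVlt => /predU1P[<-|x0].
        by rewrite powR0// gt_eqF.
      by rewrite -[leRHS](powRr0 x) ger_powR ?x0 ?x1// ltW.
    by rewrite ler_wpDl// ler_powR// ltW.
- by move=> x _; rewrite lee_fin mulr_ge0 ?pow_kernel_ge0 ?expR_ge0.
- by apply/measurable_EFinP; exact: measurable_gamma_integrand.
- by move=> x _; rewrite lee_fin mulr_ge0 ?pow_kernel_ge0 ?expR_ge0.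
- by apply/measurable_EFinP; exact: measurable_gamma_integrand.
Qed.

(** On []0, 1]] the exponential is at least [exp(-1)], so the integral is at least [exp(-1) / b]. *)
Lemma egamma_gt0 (b : R) : 0 < b -> (0 < egamma b)%E.
Proof.
move=> b0; apply: (@lt_le_trans _ _ ((expR (-1))%:E * (b^-1)%:E)%E).
  by rewrite -EFinM lte_fin mulr_gt0 ?expR_gt0 ?invr_gt0.
rewrite -integral_powR01// -ge0_integralZl; [|exact: measurable_itv| | |by rewrite lee_fin expR_ge0];
  last 2 first.
- by apply: measurable_funTS; apply/measurable_EFinP; exact: measurable_powR.
- by move=> x _; rewrite lee_fin powR_ge0.
rewrite integral_mkcond /egamma; apply: ge0_le_integral => //.
- move=> x _; rewrite erestrict_ge0// => y _.
  by rewrite -EFinM lee_fin mulr_ge0 ?expR_ge0 ?powR_ge0.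
- apply/(measurable_restrictT _ _).1 => //.
  apply: measurable_funTS; apply: measurable_funeM; apply/measurable_EFinP.
  exact: measurable_powR.
- by apply/measurable_EFinP; exact: measurable_gamma_integrand.
- move=> x _; rewrite patchE mem_setE in_itv/=; case: ifPn => [/andP[x0 x1]|_].
    rewrite -EFinM lee_fin pow_kernelE ?(ltW x0)// mulrC ler_wpM2l ?powR_ge0//.
    by rewrite ler_expR lerN2.
  by rewrite lee_fin mulr_ge0 ?pow_kernel_ge0 ?expR_ge0.
Qed.

Lemma EFin_Gamma (b : R) : 0 < b -> (Gamma b)%:E = egamma b.
Proof. by move=> b0; rewrite GammaE fineK// egamma_fin_num. Qed.

Lemma Gamma_gt0 (b : R) : 0 < b -> 0 < Gamma b.
Proof. by move=> b0; rewrite -lte_fin EFin_Gamma// egamma_gt0. Qed.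

Lemma Gamma_rec (b : R) : 0 < b -> Gamma (b + 1) = b * Gamma b.
Proof.
move=> b0; apply: EFin_inj; rewrite EFinM !EFin_Gamma//; last by rewrite addr_gt0.
exact: egamma_rec.
Qed.

Lemma dirichlet_integralE n (b : 'I_n -> R) : (forall i, 0 < b i) ->
  dirichlet_integral b 1 =
  (\prod_(i < n) Gamma (b i) / Gamma (\sum_(i < n) b i + 1))%:E.
Proof.
move=> b0.
have S0 : 0 < \sum_(i < n) b i + 1.
  by rewrite ltr_wpDl// sumr_ge0// => i _; exact: ltW.
have := dirichlet_formula b; under eq_bigr do rewrite -EFin_Gamma//.
rewrite -EFin_Gamma// prodEFin => E.
rewrite mulrC EFinM E muleA -EFinM mulVf ?mul1e//.
by rewrite gt_eqF// Gamma_gt0.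
Qed.

End gamma.

(** * Logarithmic means of barycentric coordinates *)

Section barycentric_log_mean.
Context {R : realType} d (T : measurableType d).
Variables (P : {measure set T -> \bar R}) (D : set T) (n : nat).
Variables (x : 'I_n -> T -> R) (lam : 'I_n -> R).
Hypotheses (mD : measurable D) (PD1 : P D = 1%E).
Hypothesis mx : forall i, measurable_fun D (x i).
Hypothesis x_ge0 : forall i t, D t -> 0 <= x i t.
Hypothesis x_sum1 : forall t, D t -> \sum_(i < n) x i t = 1.
Hypothesis Ex : forall i, \int[P]_(t in D) x i t = lam i.

(** The [x i] stand for all barycentric coordinates on the simplex, the last one included, and [lam]
    for their means under the probability [P]. *)
Let avg (a : 'I_n -> R) t := \sum_(i < n) x i t * a i.

Let integrable_bounded (f : T -> R) (M : R) : measurable_fun D f ->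
  (forall t, D t -> `|f t| <= M) -> P.-integrable D (EFin \o f).
Proof.
move=> mf fM; apply: measurable_bounded_integrable => //.
  by rewrite PD1 ltry.
by exists M; split; [exact: num_real|move=> y My t Dt; exact: le_trans (fM t Dt) (ltW My)].
Qed.

Let x_le1 i t : D t -> x i t <= 1.
Proof.
move=> Dt; rewrite -(x_sum1 Dt) (bigD1 i)//= lerDl sumr_ge0// => j _.
exact: x_ge0.
Qed.

Let integrable_x i : P.-integrable D (EFin \o x i).
Proof.
apply: (@integrable_bounded _ 1) => // t Dt.
by rewrite ger0_norm ?x_le1// x_ge0.
Qed.

Let integrable_xM i (c : R) : P.-integrable D (fun t => (x i t * c)%:E).
Proof. exact: (integrableZr mD c (integrable_x i)). Qed.

Let integrable_avg a : P.-integrable D (EFin \o avg a).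
Proof.
rewrite (_ : _ \o _ = fun t => (\sum_(i < n) (x i t * a i)%:E)%E).
  by apply: integrable_sum => // i _; exact: integrable_xM.
by apply/funext => t; rewrite /= sumEFin.
Qed.

Let Eavg a : \int[P]_(t in D) avg a t = \sum_(i < n) lam i * a i.
Proof.
rewrite /Rintegral; under eq_integral do rewrite /avg -sumEFin.
rewrite (integral_sum mD (fun i => integrable_xM i (a i))).
rewrite (eq_bigr (fun i => (lam i * a i)%:E)) ?sumEFin// => i _.
rewrite -Ex -RintegralZr// /Rintegral fineK//.
by apply: integrable_fin_num => //; exact: integrable_xM.
Qed.

Let Ecst r : \int[P]_(t in D) r = r.
Proof. by rewrite Rintegral_cst// PD1 mulr1. Qed.

Let integrable_cst (r : R) : P.-integrable D (EFin \o (fun=> r)).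
Proof. exact: (@integrable_bounded _ `|r|). Qed.

Let avg_ge a m t : (forall i, m <= a i) -> D t -> m <= avg a t.
Proof.
move=> ma Dt; rewrite -[m]mul1r -(x_sum1 Dt) mulr_suml ler_sum// => i _.
by rewrite ler_wpM2l ?x_ge0.
Qed.

Let avg_le a m t : (forall i, a i <= m) -> D t -> avg a t <= m.
Proof.
move=> ma Dt; rewrite -[m]mul1r -(x_sum1 Dt) mulr_suml ler_sum// => i _.
by rewrite ler_wpM2l ?x_ge0.
Qed.

Variables (a : 'I_n -> R) (m : R).
Hypotheses (m_gt0 : 0 < m) (m_le : forall i, m <= a i).

Let a_gt0 i : 0 < a i. Proof. exact: lt_le_trans (m_le i). Qed.

Let avg_gt0 t : D t -> 0 < avg a t.
Proof. by move=> Dt; apply: lt_le_trans (avg_ge m_le Dt). Qed.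

Let integrable_ln_avg : P.-integrable D (EFin \o (fun t => ln (avg a t))).
Proof.
(* As the [a_i] are positive, their sum bounds each of them, so [ln (avg a t)] lies between [ln m]
   and [ln M]. *)
pose M := \sum_(i < n) a i.
have aM i : a i <= M.
  by rewrite /M (bigD1 i)//= lerDl sumr_ge0// => j _; exact: ltW.
apply: (@integrable_bounded _ (`|ln m| + `|ln M|)).
  apply: (measurableT_comp (@measurable_ln R)).
  by apply: measurable_sum => i; apply: measurable_funM.
move=> t Dt; have lb := avg_ge m_le Dt; have ub := avg_le aM Dt.
have A0 := avg_gt0 Dt.
have M0 : 0 < M by exact: lt_le_trans ub.
have : ln m <= ln (avg a t) by rewrite ler_ln.
have : ln (avg a t) <= ln M by rewrite ler_ln.
move=> h1 h2; rewrite ler_norml; apply/andP; split.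
  apply: le_trans h2; rewrite lerNl; apply: (le_trans (ler_norm _)).
  by rewrite normrN lerDl.
by apply: (le_trans h1); apply: (le_trans (ler_norm _)); rewrite lerDr.
Qed.

Lemma log_mean_ge : ln m <= \int[P]_(t in D) ln (avg a t).
Proof.
rewrite -[leLHS]Ecst; apply: le_Rintegral => //.
by move=> t Dt; rewrite ler_ln ?posrE ?avg_gt0 ?avg_ge.
Qed.

Lemma log_mean_le M : (forall i, a i <= M) ->
  \int[P]_(t in D) ln (avg a t) <= ln M.
Proof.
move=> aM; rewrite -[leRHS]Ecst; apply: le_Rintegral => // t Dt.
have A0 := avg_gt0 Dt; have ub := avg_le aM Dt.
by rewrite ler_ln// posrE; exact: lt_le_trans ub.
Qed.

(** The logarithm is [1/m]-Lipschitz on [[m, +oo[], and [|avg a t - a_k|] is at most the average of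
    the [|a_i - a_k|] because the weights sum to 1. The bound tends to 0 as [lam] approaches the
    [k]-th vertex. *)
Lemma log_mean_dist k : `|\int[P]_(t in D) ln (avg a t) - ln (a k)| <=
  m^-1 * \sum_(i < n) lam i * `|a i - a k|.
Proof.
(* From [ln y - ln z = ln (1 + (y - z)/z) <= (y - z)/z] and [z >= m]; exchanging [y] and [z] gives
   the other side. *)
have lndist (y z : R) : m <= y -> m <= z -> ln y - ln z <= m^-1 * `|y - z|.
  move=> my mz; have y0 := lt_le_trans m_gt0 my; have z0 := lt_le_trans m_gt0 mz.
  rewrite -ln_div ?posrE//.
  rewrite (_ : y / z = 1 + (y - z) / z); last by field; rewrite gt_eqF.
  apply: (le_trans (le_ln1Dx _)).
    by rewrite mulrBl divff ?gt_eqF// ltrBrDr addNr divr_gt0.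
  rewrite mulrC; apply: (@le_trans _ _ (z^-1 * `|y - z|)).
    by rewrite ler_wpM2l ?ler_norm// invr_ge0 ltW.
  by rewrite ler_wpM2r// lef_pV2.
have avgdist t : D t -> `|avg a t - a k| <= avg (fun i => `|a i - a k|) t.
  move=> Dt; rewrite -[X in _ - X]mul1r -(x_sum1 Dt) mulr_suml -sumrB.
  apply: (le_trans (ler_norm_sum _ _ _)); apply: ler_sum => i _.
  by rewrite -mulrBr normrM ger0_norm// x_ge0.
have int1 : P.-integrable D
    (EFin \o (fun t => m^-1 * avg (fun i => `|a i - a k|) t)).
  exact: (integrableZl mD m^-1 (integrable_avg _)).
have int2 : P.-integrable D (EFin \o (fun t => ln (avg a t) - ln (a k))).
  exact: (integrableB mD integrable_ln_avg (integrable_cst _)).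
have int3 : P.-integrable D (EFin \o (fun t => ln (a k) - ln (avg a t))).
  exact: (integrableB mD (integrable_cst _) integrable_ln_avg).
have E1 : ln (a k) - \int[P]_(t in D) ln (avg a t) =
    \int[P]_(t in D) (ln (a k) - ln (avg a t)) by rewrite RintegralB// Ecst.
have E2 : \int[P]_(t in D) ln (avg a t) - ln (a k) =
    \int[P]_(t in D) (ln (avg a t) - ln (a k)) by rewrite RintegralB// Ecst.
rewrite -Eavg -RintegralZl// ler_norml lerNl opprB E1 E2.
have Vm0 : 0 <= m^-1 by rewrite invr_ge0 ltW.
apply/andP; split; apply: le_Rintegral => // t Dt.
  apply: (le_trans (lndist _ _ (m_le k) (avg_ge m_le Dt))).
  by rewrite distrC ler_wpM2l// avgdist.
apply: (le_trans (lndist _ _ (avg_ge m_le Dt) (m_le k))).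
by rewrite ler_wpM2l// avgdist.
Qed.

(** Here [avg a t = 1 + y] with [y = x_k h]. Integrating [y - 2 h^2 <= ln (1 + y) <= y] gives the
    claim, since [x_k] has mean [lam k]. *)
Lemma log_mean_taylor k h : `|h| <= 2^-1 ->
    a = (fun i => 1 + h * (i == k)%:R) ->
  lam k * h - 2 * h ^+ 2 <= \int[P]_(t in D) ln (avg a t) <= lam k * h.
Proof.
move=> h2 aE.
have avgE t : D t -> avg a t = 1 + x k t * h.
  move=> Dt; rewrite /avg aE.
  under eq_bigr do rewrite mulrDr mulr1.
  rewrite big_split/= x_sum1// (bigD1 k)//= [X in _ + (_ + X)]big1 => [|i /negPf ->].
    by rewrite eqxx addr0 mulr1.
  by rewrite !mulr0.
have intxh := integrable_xM k h.
have Exh : \int[P]_(t in D) (x k t * h) = lam k * h by rewrite RintegralZr// Ex.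
have intl : P.-integrable D (EFin \o (fun t => x k t * h - 2 * h ^+ 2)).
  exact: (integrableB mD intxh (integrable_cst _)).
have El : \int[P]_(t in D) (x k t * h - 2 * h ^+ 2) = lam k * h - 2 * h ^+ 2.
  by rewrite RintegralB// Exh Ecst.
have small t : D t -> - 2^-1 <= x k t * h <= 2^-1.
  move=> Dt; rewrite -ler_norml normrM ger0_norm ?x_ge0// -[leRHS]mul1r.
  by rewrite ler_pM// ?x_ge0// x_le1.
rewrite -El -Exh; apply/andP; split; apply: le_Rintegral => // t Dt.
- rewrite avgE//; have /andP[y1 y2] := small _ Dt.
  have : (x k t * h) ^+ 2 <= h ^+ 2.
    rewrite exprMn -[leRHS]mul1r ler_wpM2r ?sqr_ge0//.
    by rewrite expr_le1 ?x_ge0// x_le1.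
  set y := x k t * h in y1 y2 *; move=> y2h.
  have y0 : 0 < 1 + y by lra.
  (* Applying [ln (1 + u) <= u] at [1 + u = 1/(1 + y)] gives [y/(1 + y) <= ln (1 + y)]. The left
     side is at least [y - 2 h^2], because [y^2 <= h^2] and [2 (1 + y) >= 1]. *)
  have /le_ln1Dx : -1 < - y / (1 + y).
    by rewrite ltr_pdivlMr//; lra.
  rewrite (_ : 1 + - y / (1 + y) = (1 + y)^-1); last by field; rewrite gt_eqF.
  rewrite lnV ?posrE// mulNr lerN2; apply: le_trans.
  rewrite ler_pdivlMr//; nra.
- rewrite avgE//; apply: le_ln1Dx.
  by have /andP[y1 _] := small _ Dt; lra.
Qed.

End barycentric_log_mean.

(** * The measure mu_lambda *)

Section mu_lambda_moments.
Context {R : realType}.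
Local Notation T := (measurableTypeR R).
Local Notation leb n := (@lebesgue_tuple R n).

Lemma bary_max n (x : 'I_n -> R) : bary x ord_max = 1 - \sum_(j < n) x j.
Proof. by rewrite /bary unlift_none. Qed.

Lemma bary_widen n (x : 'I_n -> R) j : bary x (widen_ord (leqnSn n) j) = x j.
Proof.
rewrite (_ : widen_ord _ j = lift ord_max j) ?/bary ?liftK//.
by apply: ord_inj; rewrite lift_max.
Qed.

Lemma bary_sum n (x : 'I_n -> R) : \sum_(i < n.+1) bary x i = 1.
Proof.
rewrite big_ord_recr/= bary_max; under eq_bigr do rewrite bary_widen.
by rewrite addrC subrK.
Qed.

Lemma ord_max_widen n (i : 'I_n.+1) :
  i = ord_max \/ exists j, i = widen_ord (leqnSn n) j.
Proof.
have [j ->|->] := unliftP ord_max i; [right; exists j|by left].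
by apply: ord_inj; rewrite lift_max.
Qed.

Lemma simplexP n (t : n.-tuple T) :
  @simplex R n t <-> forall i, 0 <= bary (tnth t) i.
Proof.
split=> [[t0 t1] i|t0].
  have [->|[j ->]] := ord_max_widen i; first by rewrite bary_max subr_ge0.
  by rewrite bary_widen.
split=> [i|]; first by have := t0 (widen_ord (leqnSn n) i); rewrite bary_widen.
by have := t0 ord_max; rewrite bary_max subr_ge0.
Qed.

Lemma measurable_bary n i :
  measurable_fun setT (fun t : n.-tuple T => bary (tnth t : 'I_n -> R) i).
Proof.
have [->|[j ->]] := ord_max_widen i; last first.
  rewrite (_ : (fun _ => _) = fun t => tnth t j); first exact: measurable_tnth.
  by apply/funext => t; rewrite bary_widen.
rewrite (_ : (fun _ => _) = fun t => 1 - \sum_(j < n) (tnth t j : R)).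
  apply: measurable_funB => //; apply: measurable_sum => j.
  exact: measurable_tnth.
by apply/funext => t; rewrite bary_max.
Qed.

Lemma measurable_simplex n : measurable (@simplex R n).
Proof.
rewrite (_ : @simplex R n = \bigcap_(i in [set: 'I_n.+1])
    ((fun t : n.-tuple T => bary (tnth t : 'I_n -> R) i) @^-1` `[0, +oo[)).
  apply: fin_bigcap_measurable => // i _.
  by rewrite -[X in measurable X]setTI; exact: measurable_bary.
apply/seteqP; split=> t.
  by move=> /simplexP t0 i _; rewrite /= in_itv/= t0.
move=> t0; apply/simplexP => i.
by have := t0 i I; rewrite /= in_itv/= andbT.
Qed.

Lemma dirichlet_weight_restrict n (b : 'I_n -> R) :
  dirichlet_weight b 1 =
  (fun t : n.-tuple T => \prod_(i < n) tnth t i `^ (b i - 1)) \_ (@simplex R n).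
Proof.
apply/funext => t; rewrite patchE; case: ifPn => [|ts].
  rewrite inE => -[t0 t1]; rewrite /dirichlet_weight t1 mulr1.
  by apply: eq_bigr => i _; rewrite pow_kernelE.
rewrite /dirichlet_weight.
have [/existsP[i ti]|] := boolP [exists i : 'I_n, tnth t i < 0].
  by rewrite (bigD1 i)//= pow_kernel_lt0// !mul0r.
rewrite negb_exists => /forallP t0.
rewrite (_ : (_ <= 1) = false) ?mulr0//; apply/negbTE/negP => t1.
by move/negP : ts; apply; rewrite inE; split=> // i; rewrite leNgt t0.
Qed.

Lemma integral_simplex_prod n (b : 'I_n -> R) :
  (\int[leb n]_(t in @simplex R n)
     (\prod_(i < n) tnth t i `^ (b i - 1))%:E = dirichlet_integral b 1)%E.
Proof.
rewrite integral_mkcond /dirichlet_integral dirichlet_weight_restrict.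
by apply: eq_integral => t _; rewrite restrict_EFin.
Qed.

(** Serves twice in the first moment: for the density with one exponent raised, and for the product
    of Gamma values. *)
Lemma prod_scale1 n (F G : 'I_n -> R) i c :
  F i = c * G i -> (forall j, j != i -> F j = G j) ->
  \prod_(j < n) F j = c * \prod_(j < n) G j.
Proof.
move=> Fi FG; rewrite (bigD1 i)// [in RHS](bigD1 i)//= mulrA Fi.
by congr (_ * _); exact: eq_bigr.
Qed.

Section fixed_weights.
Variables (n : nat) (l : 'rV[R]_n).
Hypotheses (n_gt0 : (0 < n)%N) (hl : simplex_int l).

(** The measure structure on [mu_lambda l] depends on the proof [hl], so it is named in order to be
    passed explicitly. *)
Definition mu_lambda_measure : {measure set (n.-tuple T) -> \bar R} :=
  Defs_mu_lambda__canonical__measure_function_Measure hl.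

Local Notation b i := ((alpha l i)^-1).
Local Notation C :=
  ((\sum_(i < n) (alpha l i)^-1) / multi_beta (fun i => (alpha l i)^-1)).

Let L := 1 - \sum_(i < n) l ord0 i.

Let L_gt0 : 0 < L. Proof. by case: hl => _; rewrite subr_gt0. Qed.

Let bE i : b i = l ord0 i / L.
Proof. by rewrite /alpha bary_max invf_div. Qed.

Let b_gt0 i : 0 < b i.
Proof. by rewrite bE divr_gt0//; case: hl. Qed.

(** Since [b_i = lambda_i / L] with [L = lambda_(n+1)], and the [n + 1] weights sum to 1. *)
Let sum_b : \sum_(i < n) b i + 1 = L^-1.
Proof.
under eq_bigr do rewrite bE.
by rewrite -mulr_suml -[X in _ + X](@divff _ L) ?gt_eqF// -mulrDl addrC subrK mul1r.
Qed.

Let sum_b_gt0 : 0 < \sum_(i < n) b i.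
Proof.
rewrite (bigD1 (Ordinal n_gt0))//= ltr_wpDr// sumr_ge0// => i _.
exact/ltW/b_gt0.
Qed.

Let prod_Gamma_gt0 : 0 < \prod_(i < n) Gamma (b i).
Proof. by apply: prodr_gt0 => i _; exact: Gamma_gt0. Qed.

(** The factor [sum_i b_i] is absorbed by the Gamma recurrence, so [C] is the inverse of the
    Dirichlet integral; hence the total mass 1 below. *)
Let CE : C = Gamma (\sum_(i < n) b i + 1) / \prod_(i < n) Gamma (b i).
Proof. by rewrite Gamma_rec// /multi_beta/= invf_div mulrA. Qed.

Lemma mu_density_ge0 t : 0 <= mu_density l t.
Proof.
rewrite /mu_density mulr_ge0//; last by apply: prodr_ge0 => i _; exact: powR_ge0.
by rewrite CE divr_ge0 ?Gamma_ge0// ltW.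
Qed.

Lemma measurable_mu_density : measurable_fun setT (mu_density l).
Proof.
apply: measurable_funM => //; apply: measurable_prod => i _.
apply: (measurableT_comp (measurable_powR _)); exact: measurable_tnth.
Qed.

Lemma ge0_integral_mu_lambda (f : n.-tuple T -> \bar R) :
  measurable_fun setT f -> (forall t, @simplex R n t -> 0 <= f t)%E ->
  (\int[mu_lambda l]_(t in @simplex R n) f t =
   \int[leb n]_(t in @simplex R n) (f t * (mu_density l t)%:E))%E.
Proof.
move=> mf f0; apply: (@ge0_integral_density _ _ _ (leb n) mu_lambda_measure) => //.
- exact: measurable_simplex.
- apply: measurable_funTS; exact: measurable_mu_density.
- exact: mu_density_ge0.
- exact: measurable_funTS.
Qed.

Lemma mu_lambda_simplex : mu_lambda l (@simplex R n) = 1%E.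
Proof.
rewrite /mu_lambda setIid; under eq_integral do rewrite EFinM.
rewrite ge0_integralZl//; last 4 first.
- exact: measurable_simplex.
- apply: measurable_funTS; apply/measurable_EFinP; apply: measurable_prod => i _.
  by apply: (measurableT_comp (measurable_powR _)); exact: measurable_tnth.
- by move=> t _; rewrite lee_fin prodr_ge0// => i _; exact: powR_ge0.
- by rewrite lee_fin CE divr_ge0 ?Gamma_ge0// ltW.
rewrite integral_simplex_prod dirichlet_integralE// -EFinM; congr EFin.
rewrite CE mulrA mulfVK ?gt_eqF// divff// gt_eqF// Gamma_gt0//.
by rewrite addr_gt0.
Qed.

Lemma mu_lambda_moment i :
  (\int[mu_lambda l]_(t in @simplex R n) (tnth t i)%:E = (l ord0 i)%:E)%E.
Proof.
(* Multiplying the density by [t_i] raises the [i]-th parameter by 1. *)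
pose b' j := b j + (j == i)%:R.
have b'_gt0 j : 0 < b' j by rewrite ltr_wpDr.
rewrite ge0_integral_mu_lambda; last 2 first.
- by apply/measurable_EFinP; exact: measurable_tnth.
- by move=> t [t0 _]; rewrite lee_fin.
transitivity (\int[leb n]_(t in @simplex R n)
    (C%:E * (\prod_(j < n) tnth t j `^ (b' j - 1))%:E))%E.
  apply: eq_integral => t; rewrite inE => -[t0 _].
  rewrite -!EFinM mulrCA; congr (_ * _)%:E.
  apply/esym/(@prod_scale1 _ _ _ i) => [|j /negPf ji].
    by rewrite /b' eqxx addrK mulr_powRB1.
  by rewrite /b' ji addr0.
rewrite ge0_integralZl//; last 4 first.
- exact: measurable_simplex.
- apply: measurable_funTS; apply/measurable_EFinP; apply: measurable_prod => j _.
  by apply: (measurableT_comp (measurable_powR _)); exact: measurable_tnth.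
- by move=> t _; rewrite lee_fin prodr_ge0// => j _; exact: powR_ge0.
- by rewrite lee_fin CE divr_ge0 ?Gamma_ge0// ltW.
rewrite integral_simplex_prod dirichlet_integralE// -EFinM; congr EFin.
have -> : \sum_(j < n) b' j = \sum_(j < n) b j + 1.
  rewrite big_split/=; congr (_ + _); rewrite (bigD1 i)//= eqxx.
  by rewrite big1 ?addr0// => j /negPf ->.
have -> : \prod_(j < n) Gamma (b' j) = b i * \prod_(j < n) Gamma (b j).
  apply: (@prod_scale1 _ _ _ i) => [|j /negPf ji].
    by rewrite /b' eqxx Gamma_rec.
  by rewrite /b' ji addr0.
(* The Gamma quotients reduce to [b_i / (sum_j b_j + 1) = (lambda_i / L) * L]. *)
rewrite CE (@Gamma_rec _ (\sum_(j < n) b j + 1)); last by rewrite addr_gt0.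
have G0 : Gamma (\sum_(j < n) b j + 1) != 0.
  by rewrite gt_eqF// Gamma_gt0// addr_gt0.
have P0 : \prod_(j < n) Gamma (b j) != 0 by rewrite gt_eqF.
rewrite sum_b in G0 *; rewrite bE.
have L0 : L != 0 by rewrite gt_eqF.
by field; rewrite P0 G0 L0.
Qed.

Lemma mu_lambda_moment_bary i :
  \int[mu_lambda_measure]_(t in @simplex R n) bary (tnth t) i = bary (l ord0) i.
Proof.
have int j : mu_lambda_measure.-integrable (@simplex R n)
    (EFin \o (fun t => tnth t j : R)).
  apply/integrableP; split.
    by apply: measurable_funTS; apply/measurable_EFinP; exact: measurable_tnth.
  rewrite (_ : integral _ _ _ = (l ord0 j)%:E) ?ltry//.
  rewrite -mu_lambda_moment; apply: eq_integral => t; rewrite inE => -[t0 _].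
  by rewrite /= ger0_norm.
have [->|[j ->]] := ord_max_widen i; last first.
  under eq_Rintegral do rewrite bary_widen.
  by rewrite /Rintegral mu_lambda_moment bary_widen.
under eq_Rintegral do rewrite bary_max.
rewrite bary_max /Rintegral.
under eq_integral do rewrite EFinB -sumEFin.
have mS := @measurable_simplex n.
have int1 : mu_lambda_measure.-integrable (@simplex R n) (cst 1%E).
  apply/integrableP; split; first exact: measurable_cst.
  under eq_integral do rewrite /= normr1.
  by rewrite integral_cst// mul1e [X in (X < _)%E]mu_lambda_simplex ltry.
rewrite [X in fine X](@integralB _ _ _ mu_lambda_measure)//; last first.
  by apply: integrable_sum => // j _; exact: int.
rewrite integral_cst// mul1e [X in (X - _)%E]mu_lambda_simplex.
rewrite (integral_sum mS int).
rewrite (eq_bigr (fun j => (l ord0 j)%:E)) ?sumEFin//.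
by move=> j _; rewrite -[RHS]mu_lambda_moment.
Qed.

End fixed_weights.
End mu_lambda_moments.

(** * Symmetry at the barycentre *)

Section barycentre_symmetry.
Context {R : realType}.
Local Notation T := (measurableTypeR R).
Local Notation barycentre n := (const_mx n.+1%:R^-1 : 'rV[R]_n).

Lemma simplex_int_barycentre n :
  simplex_int (barycentre n).
Proof.
split=> [i|]; first by rewrite mxE invr_gt0 ltr0n.
under eq_bigr do rewrite mxE.
by rewrite sumr_const card_ord -[_ *+ n]mulr_natl ltr_pdivrMr ?ltr0n// mul1r ltr_nat.
Qed.

(** All [alpha_i] equal 1, so every exponent is 0 and the density is constant, also where some [t_i]
    vanishes; the tuple of ones is just a reference point. *)
Lemma mu_density_barycentre n (t : n.-tuple T) :
  mu_density (barycentre n) t =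
  mu_density (barycentre n) [tuple of nseq n (1 : R)].
Proof.
have alphaE (i : 'I_n) : alpha (barycentre n) i = 1.
  rewrite /alpha bary_max; under eq_bigr do rewrite mxE.
  rewrite mxE sumr_const card_ord -[_ *+ n]mulr_natl.
  rewrite -natr1; field; by rewrite natr1 pnatr_eq0.
rewrite /mu_density; congr (_ * _); apply: eq_bigr => i _.
by rewrite alphaE invr1 subrr !powRr0.
Qed.

Lemma bary_tuple_reflect n (j : 'I_n) (t : n.-tuple T) i :
  bary (tnth (tuple_reflect 1 j t) : 'I_n -> R) i =
  bary (tnth t : 'I_n -> R) (tperm ord_max (widen_ord (leqnSn n) j) i).
Proof.
have wD (k : 'I_n) : ord_max != widen_ord (leqnSn n) k.
  by rewrite -val_eqE /= gtn_eqF.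
have [->|[k ->]] := ord_max_widen i.
  rewrite tpermL bary_widen bary_max (bigD1 j)//= tnth_mktuple eqxx.
  under eq_bigr => k /negPf kj do rewrite tnth_mktuple kj.
  by rewrite (bigD1 j)//=; ring.
rewrite bary_widen tnth_mktuple; case: eqVneq => [->|kj].
  by rewrite tpermR bary_max.
rewrite tpermD ?bary_widen//.
by rewrite -val_eqE /= eq_sym.
Qed.

Lemma simplex_tuple_reflect n (j : 'I_n) (t : n.-tuple T) :
  @simplex R n (tuple_reflect 1 j t) <-> @simplex R n t.
Proof.
split=> /simplexP t0; apply/simplexP => i; last by rewrite bary_tuple_reflect.
have := t0 (tperm ord_max (widen_ord (leqnSn n) j) i).
by rewrite bary_tuple_reflect tpermK.
Qed.

(** The density is constant and the reflection preserves both the simplex and Lebesgue measure. A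
    signed [F], such as a logarithm, is split into its positive and negative parts. *)
Lemma integral_mu_barycentre_reflect n (j : 'I_n) (F : n.-tuple T -> \bar R) :
  measurable_fun setT F ->
  (\int[mu_lambda (barycentre n)]_(t in @simplex R n)
     F (tuple_reflect 1 j t) =
   \int[mu_lambda (barycentre n)]_(t in @simplex R n) F t)%E.
Proof.
have n0 : (0 < n)%N by apply: leq_ltn_trans (ltn_ord j).
have hl := @simplex_int_barycentre n.
suff ge0_case G : measurable_fun setT G -> (forall t, 0 <= G t)%E ->
  (\int[mu_lambda (barycentre n)]_(t in @simplex R n)
     G (tuple_reflect 1 j t) =
   \int[mu_lambda (barycentre n)]_(t in @simplex R n) G t)%E.
  move=> mF; rewrite integralE [RHS]integralE; congr (_ - _)%E.
    rewrite -[RHS](ge0_case _ (measurable_funepos mF) (funepos_ge0 _)).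
    by apply: eq_integral => t _; rewrite !funeposE.
  rewrite -[RHS](ge0_case _ (measurable_funeneg mF) (funeneg_ge0 _)).
  by apply: eq_integral => t _; rewrite !funenegE.
move=> mG G0.
have mGr : measurable_fun setT (G \o tuple_reflect 1 j).
  by apply: measurableT_comp => //; exact: measurable_tuple_reflect.
rewrite !ge0_integral_mu_lambda//.
set c := mu_density (barycentre n) [tuple of nseq n (1 : R)].
have c0 : 0 <= c by exact: mu_density_ge0.
under eq_integral do rewrite mu_density_barycentre.
under [RHS]eq_integral do rewrite mu_density_barycentre.
rewrite integral_mkcond [RHS]integral_mkcond.
rewrite -[RHS](ge0_integral_tuple_reflect 1 j).
- apply: eq_integral => t _; rewrite !patchE.
  have -> // : (tuple_reflect 1 j t \in @simplex R n) = (t \in @simplex R n).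
  by apply/idP/idP; rewrite !inE => /simplex_tuple_reflect.
- apply/(measurable_restrictT _ _).1; first exact: measurable_simplex.
  by apply: measurable_funTS; apply: emeasurable_funM.
- by move=> t; apply: erestrict_ge0 => u _; rewrite mule_ge0// lee_fin.
Qed.

Lemma I_mean_barycentre_sym n (s : 'S_n.+1) (a : 'rV[R]_n.+1) :
  I_mean (barycentre n) (col_perm s a) = I_mean (barycentre n) a.
Proof.
(* The transpositions involving the last index generate the symmetric group; induction runs over a
   product of such generators. *)
have := finset.in_setT s; rewrite -(gen_tperm ord_max).
move=> /gen_prodgP[m [c cT ->]] {s}; elim/big_rec: _ a => [a|i s _ IH a].
  by rewrite col_perm1.
rewrite col_permM.
have -> : forall a, I_mean (barycentre n) (col_perm (c i) a) =
    I_mean (barycentre n) a; last exact: IH.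
move=> {}a; have /imsetP[y _ ->] := cT i.
have [->|[j ->]] := ord_max_widen y; first by rewrite tperm1 col_perm1.
rewrite /I_mean; congr (expR (fine _)).
rewrite -[RHS](integral_mu_barycentre_reflect j).
  apply: (@eq_integral _ _ _ (mu_lambda_measure (simplex_int_barycentre n))).
  move=> t _; congr (ln _)%:E.
  (* Reindexing the sum moves the transposition from the barycentric coordinates to the entries of
     [a]. *)
  rewrite [RHS](reindex_inj (@perm_inj _ (tperm ord_max (widen_ord (leqnSn n) j)))).
  by apply: eq_bigr => k _; rewrite bary_tuple_reflect tpermK mxE.
apply/measurable_EFinP; apply: (measurableT_comp (@measurable_ln R)).
apply: measurable_sum => k; apply: measurable_funM => //.
exact: measurable_bary.
Qed.

End barycentre_symmetry.

(** * The mean I_lambda *)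

Section identric_mean.
Context {R : realType}.
Variables (n : nat) (n_gt0 : (0 < n)%N).
Local Notation T := (measurableTypeR R).
Local Notation x i t := (bary (tnth t : 'I_n -> R) i).

Let mx i : measurable_fun (@simplex R n) (fun t => x i t).
Proof. by apply: measurable_funTS; exact: measurable_bary. Qed.

Let x_ge0 i t : @simplex R n t -> 0 <= x i t.
Proof. by move=> /simplexP. Qed.

Let x_sum1 t : @simplex R n t -> \sum_(i < n.+1) x i t = 1.
Proof. by move=> _; exact: bary_sum. Qed.

Let amin (a : 'rV[R]_n.+1) := \big[Num.min/a ord0 ord0]_(i < n.+1) a ord0 i.

Let min_gt0 a : positive_orthant a -> 0 < amin a.
Proof. by move=> a0; apply: lt_bigmin. Qed.

Let min_le a i : amin a <= a ord0 i.
Proof. exact: bigmin_le. Qed.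

Lemma I_mean_min_max (l : 'rV[R]_n) (a : 'rV[R]_n.+1) :
    simplex_int l -> positive_orthant a ->
  \big[Num.min/a ord0 ord0]_(i < n.+1) a ord0 i <= I_mean l a
    <= \big[Num.max/a ord0 ord0]_(i < n.+1) a ord0 i.
Proof.
move=> hl a0; set M := (X in _ <= _ <= X).
have aM i : a ord0 i <= M by exact: le_bigmax.
have M0 : 0 < M by exact: lt_le_trans (aM ord0).
have P1 := mu_lambda_simplex n_gt0 hl.
apply/andP; split.
  rewrite -[leLHS]lnK ?posrE ?min_gt0// ler_expR.
  exact: (log_mean_ge (P := mu_lambda_measure hl) (@measurable_simplex R n)
    P1 mx x_ge0 x_sum1 (min_gt0 a0) (min_le a)).
rewrite -[leRHS]lnK// ler_expR.
exact: (log_mean_le (P := mu_lambda_measure hl) (@measurable_simplex R n)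
    P1 mx x_ge0 x_sum1 (min_gt0 a0) (min_le a) aM).
Qed.

Let continuous_bary (v : 'rV[R]_n) i :
  bary (l ord0) i @[l --> nbhs v] --> bary (v ord0) i.
Proof.
have [->|[j ->]] := ord_max_widen i; last first.
  under eq_fun do rewrite bary_widen.
  by rewrite bary_widen; exact: coord_continuous.
under eq_fun do rewrite bary_max.
rewrite bary_max; apply: cvgB; first exact: cvg_cst.
by apply: cvg_big => [|j _]; [exact: add_continuous|exact: coord_continuous].
Qed.

Let expo (l : 'rV[R]_n) (a : 'rV[R]_n.+1) : R :=
  fine (\int[mu_lambda l]_(t in @simplex R n)
    (ln (\sum_(i < n.+1) bary (tnth t) i * a ord0 i))%:E)%E.

(** The hypothesis on [v] covers the vertices [e_i] and [0] alike. The logarithm of the mean is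
    squeezed around [ln a_k] by [log_mean_dist]. *)
Lemma I_mean_cvg_vertex (v : 'rV[R]_n) k (a : 'rV[R]_n.+1) :
    positive_orthant a -> (forall i, i != k -> bary (v ord0) i = 0) ->
  I_mean l a @[l --> within (@simplex_int R n) (nbhs v)] --> a ord0 k.
Proof.
move=> a0 vk; rewrite -[X in _ --> X]lnK ?posrE//.
suff E : expo l a @[l --> within (@simplex_int R n) (nbhs v)] --> ln (a ord0 k).
  rewrite (_ : (fun l => _) = (@expR R) \o (expo^~ a))//.
  by apply: (cvg_comp _ _ E); exact: continuous_expR.
(* [g] is the error bound of [log_mean_dist]. It is continuous and vanishes at [v]: the [k]-th term
   has [|a_k - a_k| = 0], the others have weight 0. *)
pose g (l : 'rV[R]_n) := (amin a)^-1 *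
  \sum_(i < n.+1) bary (l ord0) i * `|a ord0 i - a ord0 k|.
have gv : g v = 0.
  rewrite /g big1 ?mulr0// => i _; have [->|ik] := eqVneq i k.
    by rewrite subrr normr0 mulr0.
  by rewrite vk// mul0r.
have gc : g l @[l --> nbhs v] --> g v.
  apply: cvgM; first exact: cvg_cst.
  apply: cvg_big => [|i _]; first exact: add_continuous.
  by apply: cvgM; [exact: continuous_bary|exact: cvg_cst].
have g0 : g l @[l --> within (@simplex_int R n) (nbhs v)] --> 0.
  by rewrite -gv; exact: cvg_within_filter.
apply: (@squeeze_cvgr _ _ _ _ (fun l => ln (a ord0 k) - g l)
                              (fun l => ln (a ord0 k) + g l)).
- rewrite near_withinE; near=> l => hl.
  rewrite -ler_distl.
  exact: (log_mean_dist (P := mu_lambda_measure hl) (@measurable_simplex R n)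
    (mu_lambda_simplex n_gt0 hl) mx x_ge0 x_sum1
    (mu_lambda_moment_bary n_gt0 hl) (min_gt0 a0) (min_le a)).
- by rewrite -[X in _ --> X]subr0; apply: cvgB => //; exact: cvg_cst.
- by rewrite -[X in _ --> X]addr0; apply: cvgD => //; exact: cvg_cst.
Unshelve. all: by end_near. Qed.

Let expo_taylor l k h : simplex_int l -> `|h| <= 2^-1 ->
  bary (l ord0) k * h - 2 * h ^+ 2 <=
  expo l (h *: delta_mx ord0 k + const_mx 1) <= bary (l ord0) k * h.
Proof.
move=> hl h2; set a : 'rV[R]_n.+1 := h *: _ + _.
have aiE i : a ord0 i = 1 + h * (i == k)%:R by rewrite !mxE eqxx addrC.
have aE : (fun i => a ord0 i) = (fun i => 1 + h * (i == k)%:R) by exact/funext.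
(* The entries are [1] or [1 + h] with [|h| <= 1/2], so [1/2] is an admissible lower bound [m]. *)
have a0 i : 2^-1 <= a ord0 i.
  rewrite aiE; move: h2; rewrite ler_norml => /andP[h1 _].
  by case: (i == k); rewrite ?mulr1 ?mulr0; lra.
have half : 0 < 2^-1 :> R by rewrite invr_gt0.
exact: (log_mean_taylor (P := mu_lambda_measure hl) (@measurable_simplex R n)
    (mu_lambda_simplex n_gt0 hl) mx x_ge0 x_sum1
    (mu_lambda_moment_bary n_gt0 hl) half a0 h2 aE).
Qed.

(** Along the line through [(1, ..., 1)] in direction [k] the mean is [exp(phi(h))]. The Taylor
    bounds give [phi(0) = 0] and [phi'(0) = lambda_k], and the chain rule with [exp'(0) = 1]
    concludes. *)
Lemma I_mean_is_derive (l : 'rV[R]_n) k : simplex_int l ->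
  is_derive (const_mx 1 : 'rV[R]_n.+1) (delta_mx ord0 k) (I_mean l)
    (bary (l ord0) k).
Proof.
have sandwich (p q s : R) : q - 2 * s <= p -> p <= q -> 0 <= s ->
    `|p - q| <= 2 * s.
  by move=> *; rewrite ler_norml; apply/andP; split; lra.
move=> hl; pose phi h : R := expo l (h *: delta_mx ord0 k + const_mx 1).
have phi0 : phi 0 = 0.
  have := @expo_taylor l k 0 hl; rewrite normr0 invr_ge0 ler0n -/(phi 0) => /(_ isT).
  by rewrite expr0n/= !mulr0 subr0 -eq_le => /eqP.
have n0 : `|h| @[h --> (0 : R)^'] --> (0 : R).
  apply/cvgr0Pnorm_le => e e0; near=> h; rewrite normr_id.
  by near: h; exact: dnbhs0_le.
have n2 : 2 * `|h| @[h --> (0 : R)^'] --> (0 : R).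
  by rewrite -[X in _ --> X](mulr0 2); apply: cvgM => //; exact: cvg_cst.
have dphi : is_derive (0 : R) 1 phi (bary (l ord0) k).
  have lim : (h^-1 *: ((phi \o shift 0) (h *: 1) - phi 0)) @[h --> 0^'] -->
      bary (l ord0) k.
    apply: (@squeeze_cvgr _ _ _ _ (fun h => bary (l ord0) k - 2 * `|h|)
                                  (fun h => bary (l ord0) k + 2 * `|h|)).
    - near=> h.
      have h0 : h != 0 by near: h; exact: nbhs_dnbhs_neq.
      have h2 : `|h| <= 2^-1.
        near: h; apply: dnbhs0_le; by rewrite invr_gt0.
      rewrite -ler_distl /= phi0 subr0 addr0 /GRing.scale/= mulr1.
      have /andP[lb ub] := @expo_taylor l k h hl h2.
      rewrite -/(phi h) in lb ub.
      (* Multiplied by [|h|], the bound on the quotient becomes [|phi(h) - lambda_k h| <= 2 h^2],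
         which handles both signs of [h]. *)
      rewrite -(ler_pM2l (_ : 0 < `|h|)) ?normr_gt0// -normrM mulrBr mulVKf//.
      rewrite mulrCA -[X in 2 * X]normrM -expr2 [X in 2 * X]ger0_norm ?sqr_ge0//.
      by rewrite [X in _ - X]mulrC; apply: sandwich; rewrite ?sqr_ge0.
    - rewrite -[X in _ --> X]subr0; apply: cvgB; first exact: cvg_cst.
      exact: n2.
    - rewrite -[X in _ --> X]addr0; apply: cvgD; first exact: cvg_cst.
      exact: n2.
  apply: DeriveDef; first by apply/cvg_ex; exists (bary (l ord0) k).
  exact: cvg_lim.
have dexp : is_derive (phi 0) 1 (@expR R) 1.
  by rewrite phi0; have := is_derive_expR (0 : R); rewrite expR0.
have := is_derive1_comp dexp dphi; rewrite mul1r => -[dm mE].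
(* The directional difference quotient of the mean is identified with that of [exp] composed with
   [phi] at 0. *)
have mE1 h : (I_mean l \o shift (const_mx 1)) (h *: delta_mx ord0 k) =
    ((@expR R \o phi) \o shift 0) (h *: 1).
  rewrite -[LHS]/(expR (phi h)) -[RHS]/(expR (phi (h * 1 + 0))).
  by rewrite mulr1 addr0.
have mE0 : I_mean l (const_mx 1) = (@expR R \o phi) 0.
  rewrite -[LHS]/(expR (expo l (const_mx 1))) -[RHS]/(expR (phi 0)).
  by rewrite /phi scale0r add0r.
have quotE : (fun h : R => h^-1 *: ((I_mean l \o shift (const_mx 1))
      (h *: delta_mx ord0 k : 'rV[R]_n.+1) - I_mean l (const_mx 1))) =
    (fun h => h^-1 *: (((@expR R \o phi) \o shift 0) (h *: 1) - (@expR R \o phi) 0)).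
  by apply/funext => h; rewrite mE1 mE0.
apply: DeriveDef; first by rewrite /derivable quotE.
by rewrite /derive quotE.
Unshelve. all: by end_near. Qed.

End identric_mean.

Theorem proposition4p4 (R : realType) (n : nat) (hn : (1 <= n)%N) :
  weighted_multivariate_mean (@I_mean R n).
Proof.
split.
- by move=> l a _ _; exact: expR_gt0.
- by move=> l a; exact: I_mean_min_max.
- move=> a a0; split=> [i|]; apply: I_mean_cvg_vertex => // j.
    have [->|[k ->]] := ord_max_widen j.
      move=> _; rewrite bary_max (bigD1 i)//= mxE !eqxx big1 ?addr0 ?subrr//.
      by move=> k /negPf ki; rewrite mxE ki andbF.
    rewrite bary_widen mxE eqxx/=; case: (eqVneq k i) => [->|//].
    by rewrite eqxx.
  have [->|[k ->]] := ord_max_widen j; first by rewrite eqxx.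
  by rewrite bary_widen mxE.
- by move=> s a _; exact: I_mean_barycentre_sym.
- move=> l hl i; by have [] := I_mean_is_derive hn i hl.
Qed.
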